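(* Let $k$ be a field of characteristic $0$, $A$ a commutative $k$-algebra, and $X$ a finite dimensional cosimplicial $A$-module. Let $A'$ be a commutative $A$-algebra. Then the natural base change map $$\Omega(X)\otimes_AA'\to\Omega(X\otimes_AA')$$ is an isomorphism.
   Context: A cosimplicial $A$-module $X$ is finite dimensional if its normalization $N^i(X)=\{x\in X^i\mid\sigma^j(x)=0\text{ for all codegeneracies }\sigma^j\}$ vanishes for all sufficiently large $i$. Thom–Sullivan functor: $\Omega_p=k[t_0,\dots,t_p,dt_0,\dots,dt_p]/(\sum t_i-1,\sum dt_i)$ is the commutative dg algebra of polynomial differential forms on the $p$-simplex, simplicial in $p$. For a cosimplicial $A$-module $X$, $\Omega^n(X)$ is the $A$-module of all families $\{x_p\in\Omega^n_p\otimes_kX^p\}_{p\ge0}$ with $(\alpha^*\otimes1)(x_q)=(1\otimes\alpha_* )(x_p)$ in $\Omega_p^n\otimes_kX^q$ for every nondecreasing $\alpha:[p]\to[q]$; $\Omega(X)$ is the complex with terms $\Omega^n(X)$ and the de Rham differential. *)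

(* Defs.v *)
From HB Require Import structures.
From mathcomp Require Import all_boot all_order all_algebra.
From mathcomp Require Import boolp mpoly zify.

Set Implicit Arguments.
Unset Strict Implicit.
Unset Printing Implicit Defensive.

Import GRing.Theory.

Local Open Scope ring_scope.
Local Open Scope quotient_scope.

Record submodule (R : pzRingType) (V : lmodType R) := Submodule {
  in_submodule :> V -> Prop;
  submodule0 : in_submodule 0;
  submoduleD : forall x y, in_submodule x -> in_submodule y ->
    in_submodule (x + y);
  submoduleZ : forall a x, in_submodule x -> in_submodule (a *: x) }.
Arguments in_submodule : simpl never.

Section ModuleQuotient.
Variables (R : pzRingType) (V : lmodType R) (I : submodule V).

Lemma submoduleN x : I x -> I (- x).
Proof. by move=> Ix; rewrite -scaleN1r; apply: submoduleZ. Qed.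

Lemma submodule_sum (J : Type) (r : seq J) (P : pred J) (F : J -> V) :
  (forall j, P j -> I (F j)) -> I (\sum_(j <- r | P j) F j).
Proof.
move=> IF; elim/big_ind: _ => //; [exact: submodule0|exact: submoduleD].
Qed.

Definition mquot_rel (x y : V) : bool := `[< I (x - y) >].

Lemma mquot_rel_refl : reflexive mquot_rel.
Proof. by move=> x; apply/asboolP; rewrite subrr; apply: submodule0. Qed.

Lemma mquot_rel_sym : ssrbool.symmetric mquot_rel.
Proof.
by move=> x y; apply: asbool_equiv_eq; split=> /submoduleN; rewrite opprB.
Qed.

Lemma mquot_rel_trans : transitive mquot_rel.
Proof.
move=> y x z /asboolP xy /asboolP yz; apply/asboolP.
by rewrite -(subrKA y); apply: submoduleD.
Qed.

Canonical mquot_equiv :=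
  EquivRel mquot_rel mquot_rel_refl mquot_rel_sym mquot_rel_trans.

Definition mquot := {eq_quot mquot_equiv}.
HB.instance Definition _ := Choice.on mquot.

Definition mquot_pi (x : V) : mquot := \pi_({eq_quot mquot_equiv}) x.
Definition mquot_repr (x : mquot) : V := repr (x : {eq_quot mquot_equiv}).

Lemma mquot_reprK x : mquot_pi (mquot_repr x) = x.
Proof. exact: reprK. Qed.

Lemma mquot_piP x y : mquot_pi x = mquot_pi y <-> I (x - y).
Proof.
split=> [/eqmodP/asboolP //|xy]; apply/eqmodP; exact/asboolP.
Qed.

Lemma mquot_reprP x : I (mquot_repr (mquot_pi x) - x).
Proof. by apply/mquot_piP; rewrite mquot_reprK. Qed.

Definition mquot_add (x y : mquot) := mquot_pi (mquot_repr x + mquot_repr y).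
Definition mquot_opp (x : mquot) := mquot_pi (- mquot_repr x).
Definition mquot_scale (a : R) (x : mquot) := mquot_pi (a *: mquot_repr x).

Lemma mquot_addE x y : mquot_add (mquot_pi x) (mquot_pi y) = mquot_pi (x + y).
Proof.
apply/mquot_piP; rewrite opprD addrACA.
by apply: submoduleD; apply: mquot_reprP.
Qed.

Lemma mquot_oppE x : mquot_opp (mquot_pi x) = mquot_pi (- x).
Proof. by apply/mquot_piP; rewrite -opprD; apply/submoduleN/mquot_reprP. Qed.

Lemma mquot_scaleE a x : mquot_scale a (mquot_pi x) = mquot_pi (a *: x).
Proof. by apply/mquot_piP; rewrite -scalerBr; apply/submoduleZ/mquot_reprP. Qed.

Lemma mquot_addA : associative mquot_add.
Proof.
move=> x y z; rewrite -(mquot_reprK x) -(mquot_reprK y) -(mquot_reprK z).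
by rewrite !mquot_addE addrA.
Qed.

Lemma mquot_addC : commutative mquot_add.
Proof. by move=> x y; rewrite /mquot_add addrC. Qed.

Lemma mquot_add0 : left_id (mquot_pi 0) mquot_add.
Proof. by move=> x; rewrite -(mquot_reprK x) mquot_addE add0r. Qed.

Lemma mquot_addN : left_inverse (mquot_pi 0) mquot_opp mquot_add.
Proof. by move=> x; rewrite -(mquot_reprK x) mquot_oppE mquot_addE addNr. Qed.

HB.instance Definition _ :=
  GRing.isZmodule.Build mquot mquot_addA mquot_addC mquot_add0 mquot_addN.

Lemma mquot_scaleA a b x :
  mquot_scale a (mquot_scale b x) = mquot_scale (a * b) x.
Proof. by rewrite -(mquot_reprK x) !mquot_scaleE scalerA. Qed.

Lemma mquot_scale1 : left_id 1 mquot_scale.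
Proof. by move=> x; rewrite -(mquot_reprK x) mquot_scaleE scale1r. Qed.

Lemma mquot_scaleDr : right_distributive mquot_scale +%R.
Proof.
move=> a x y; rewrite -(mquot_reprK x) -(mquot_reprK y).
by rewrite [_ + _]mquot_addE !mquot_scaleE [RHS]mquot_addE scalerDr.
Qed.

Lemma mquot_scaleDl x : {morph mquot_scale^~ x : a b / a + b}.
Proof.
move=> a b; rewrite -(mquot_reprK x) !mquot_scaleE [RHS]mquot_addE.
by rewrite scalerDl.
Qed.

HB.instance Definition _ := GRing.Zmodule_isLmodule.Build R mquot
  mquot_scaleA mquot_scale1 mquot_scaleDr mquot_scaleDl.

Lemma mquot_pi_is_linear : linear mquot_pi.
Proof.
by move=> a x y; rewrite -mquot_addE -mquot_scaleE.
Qed.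

HB.instance Definition _ :=
  GRing.isLinear.Build R V mquot _ mquot_pi mquot_pi_is_linear.

Lemma mquot_pi0 x : mquot_pi x = 0 <-> I x.
Proof. by rewrite -(raddf0 mquot_pi) mquot_piP subr0. Qed.

End ModuleQuotient.

Section ModuleQuotientMap.
Variables (R : pzRingType) (V W : lmodType R).
Variables (I : submodule V) (J : submodule W).
Variables (u : {linear V -> W}) (uIJ : forall x, I x -> J (u x)).

Definition mquot_map of (forall x, I x -> J (u x)) :=
  fun x : mquot I => mquot_pi J (u (mquot_repr x)).

Lemma mquot_mapE x : mquot_map uIJ (mquot_pi I x) = mquot_pi J (u x).
Proof. by apply/mquot_piP; rewrite -raddfB; apply/uIJ/mquot_reprP. Qed.

Lemma mquot_map_is_linear : linear (mquot_map uIJ).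
Proof.
move=> a x y; rewrite -(mquot_reprK x) -(mquot_reprK y).
by rewrite -linearP !mquot_mapE !linearP.
Qed.

HB.instance Definition _ :=
  GRing.isLinear.Build R (mquot I) (mquot J) _ (mquot_map uIJ)
    mquot_map_is_linear.

End ModuleQuotientMap.

(** For a morphism [f : R -> S] of commutative rings, an [R]-module [M] and an
    [S]-module [N], [tens f M N] is [M ⊗_R N] with [S] acting through [N].
    It consists of formal sums of pairs [(m, n)], modulo the least additive
    congruence making [(m, n)] biadditive and [R]-balanced; [tens_zero] is
    there because formal sums have no opposites.  Algebras are given throughout
    by ring morphisms, since the [algType] structures exclude the zero ring. *)
Section Tensor.
Variables (R S : comPzRingType) (f : {rmorphism R -> S}).
Variables (M : lmodType R) (N : lmodType S).

Inductive tens_cong : seq (M * N) -> seq (M * N) -> Prop :=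
| tens_refl s : tens_cong s s
| tens_sym s t : tens_cong s t -> tens_cong t s
| tens_trans s t u : tens_cong s t -> tens_cong t u -> tens_cong s u
| tens_cat s s' t t' : tens_cong s s' -> tens_cong t t' ->
    tens_cong (s ++ t) (s' ++ t')
| tens_comm s t : tens_cong (s ++ t) (t ++ s)
| tens_zero m : tens_cong [:: (m, 0)] [::]
| tens_addl m m' n :
    tens_cong [:: (m + m', n)] [:: (m, n); (m', n)]
| tens_addr m n n' :
    tens_cong [:: (m, n + n')] [:: (m, n); (m, n')]
| tens_bal r m n : tens_cong [:: (r *: m, n)] [:: (m, f r *: n)].

Definition tens_rel s t : bool := `[< tens_cong s t >].

Lemma tens_rel_refl : reflexive tens_rel.
Proof. by move=> x; apply/asboolP/tens_refl. Qed.

Lemma tens_rel_sym : ssrbool.symmetric tens_rel.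
Proof. by move=> x y; apply: asbool_equiv_eq; split=> /tens_sym. Qed.

Lemma tens_rel_trans : transitive tens_rel.
Proof.
by move=> y x z /asboolP xy /asboolP yz; apply/asboolP/(tens_trans xy).
Qed.

Canonical tens_equiv :=
  EquivRel tens_rel tens_rel_refl tens_rel_sym tens_rel_trans.

Definition tens := {eq_quot tens_equiv}.
HB.instance Definition _ := Choice.on tens.

Definition tens_pi (s : seq (M * N)) : tens := \pi_({eq_quot tens_equiv}) s.
Definition tens_repr (x : tens) : seq (M * N) :=
  repr (x : {eq_quot tens_equiv}).

Lemma tens_reprK x : tens_pi (tens_repr x) = x.
Proof. exact: reprK. Qed.

Lemma tens_piP s t : tens_pi s = tens_pi t <-> tens_cong s t.
Proof.
split=> [/eqmodP/asboolP //|xy]; apply/eqmodP; exact/asboolP.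
Qed.

Lemma tens_reprP s : tens_cong (tens_repr (tens_pi s)) s.
Proof. by apply/tens_piP; rewrite tens_reprK. Qed.

Definition tens_scale_seq (a : S) (s : seq (M * N)) :=
  [seq (p.1, a *: p.2) | p <- s].

Definition tens_add (x y : tens) := tens_pi (tens_repr x ++ tens_repr y).
Definition tens_scale (a : S) (x : tens) :=
  tens_pi (tens_scale_seq a (tens_repr x)).
Definition tens_opp (x : tens) := tens_scale (-1) x.

Lemma tens_addE s t : tens_add (tens_pi s) (tens_pi t) = tens_pi (s ++ t).
Proof. by apply/tens_piP/tens_cat; apply: tens_reprP. Qed.

Lemma tens_scale_seq_cong a s t :
  tens_cong s t -> tens_cong (tens_scale_seq a s) (tens_scale_seq a t).
Proof.
elim=> {s t} [s|s t _|s t u _ IH1 _ IH2|s s' t t' _ IH1 _ IH2|s t|m|m m' n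
  |m n n'|r m n].
- exact: tens_refl.
- exact: tens_sym.
- exact: tens_trans IH2.
- by rewrite /tens_scale_seq !map_cat; apply: tens_cat.
- by rewrite /tens_scale_seq !map_cat; apply: tens_comm.
- by rewrite /= scaler0; apply: tens_zero.
- exact: tens_addl.
- by rewrite /= scalerDr; apply: tens_addr.
- by rewrite /= scalerA mulrC -scalerA; apply: tens_bal.
Qed.

Lemma tens_scaleE a s :
  tens_scale a (tens_pi s) = tens_pi (tens_scale_seq a s).
Proof. by apply/tens_piP/tens_scale_seq_cong/tens_reprP. Qed.

Lemma tens_addA : associative tens_add.
Proof.
move=> x y z; rewrite -(tens_reprK x) -(tens_reprK y) -(tens_reprK z).
by rewrite !tens_addE catA.
Qed.

Lemma tens_addC : commutative tens_add.
Proof. by move=> x y; apply/tens_piP/tens_comm. Qed.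

Lemma tens_add0 : left_id (tens_pi [::]) tens_add.
Proof. by move=> x; rewrite -(tens_reprK x) tens_addE. Qed.

Lemma tens_scaleDl x : {morph tens_scale^~ x : a b / a + b >-> tens_add a b}.
Proof.
move=> a b; rewrite -(tens_reprK x) !tens_scaleE tens_addE.
apply/tens_piP; elim: (tens_repr x) => [|[m n] s IH] /=; first exact: tens_refl.
rewrite -cat1s scalerDl.
apply: (tens_trans (tens_cat (tens_addr _ _ _) IH)).
set sa := tens_scale_seq a s; set sb := tens_scale_seq b s.
change (tens_cong ([:: (m, a *: n)] ++ ([:: (m, b *: n)] ++ sa ++ sb))
  ([:: (m, a *: n)] ++ (sa ++ [:: (m, b *: n)] ++ sb))).
apply: tens_cat; first exact: tens_refl.
by rewrite !catA; apply: tens_cat; [exact: tens_comm|exact: tens_refl].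
Qed.

Lemma tens_scale0 x : tens_scale 0 x = tens_pi [::].
Proof.
rewrite -(tens_reprK x) tens_scaleE; apply/tens_piP.
elim: (tens_repr x) => [|[m n] s IH] /=; first exact: tens_refl.
rewrite scale0r -cat1s -[X in tens_cong _ X]cat0s.
exact: tens_cat (tens_zero m) IH.
Qed.

Lemma tens_scaleA a b x : tens_scale a (tens_scale b x) = tens_scale (a * b) x.
Proof.
rewrite -(tens_reprK x) !tens_scaleE /tens_scale_seq -map_comp.
by congr tens_pi; apply: eq_map => p /=; rewrite scalerA.
Qed.

Lemma tens_scale1 : left_id 1 tens_scale.
Proof.
move=> x; rewrite -[RHS]tens_reprK -{1}(tens_reprK x) tens_scaleE.
by congr tens_pi; apply: map_id_in => -[m n] _; rewrite /= scale1r.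
Qed.

Lemma tens_addN : left_inverse (tens_pi [::]) tens_opp tens_add.
Proof.
move=> x; rewrite -[X in tens_add _ X]tens_scale1 /tens_opp -tens_scaleDl.
by rewrite addNr tens_scale0.
Qed.

HB.instance Definition _ :=
  GRing.isZmodule.Build tens tens_addA tens_addC tens_add0 tens_addN.

Lemma tens_scaleDr : right_distributive tens_scale +%R.
Proof.
move=> a x y; rewrite -(tens_reprK x) -(tens_reprK y).
rewrite [_ + _]tens_addE !tens_scaleE [RHS]tens_addE.
by rewrite /tens_scale_seq map_cat.
Qed.

HB.instance Definition _ := GRing.Zmodule_isLmodule.Build S tens
  tens_scaleA tens_scale1 tens_scaleDr tens_scaleDl.

Definition tmul (m : M) (n : N) : tens := tens_pi [:: (m, n)].

Lemma tens_pi_sum s : tens_pi s = \sum_(p <- s) tmul p.1 p.2.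
Proof.
elim: s => [|[m n] s IH]; first by rewrite big_nil.
by rewrite big_cons -IH [RHS]tens_addE.
Qed.

Lemma tmulDl m m' n : tmul (m + m') n = tmul m n + tmul m' n.
Proof. by rewrite [RHS]tens_addE; apply/tens_piP/tens_addl. Qed.

Lemma tmulDr m n n' : tmul m (n + n') = tmul m n + tmul m n'.
Proof. by rewrite [RHS]tens_addE; apply/tens_piP/tens_addr. Qed.

Lemma tmul_bal r m n : tmul (r *: m) n = tmul m (f r *: n).
Proof. by apply/tens_piP/tens_bal. Qed.

Lemma tmulZ a m n : tmul m (a *: n) = a *: tmul m n.
Proof. by rewrite [RHS]tens_scaleE. Qed.

Record balanced (P : zmodType) (b : M -> N -> P) : Prop := Balanced {
  balancedDl : forall m m' n, b (m + m') n = b m n + b m' n;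
  balancedDr : forall m n n', b m (n + n') = b m n + b m n';
  balancedZ : forall r m n, b (r *: m) n = b m (f r *: n) }.

Definition tens_lift (P : zmodType) (b : M -> N -> P) (x : tens) : P :=
  \sum_(p <- tens_repr x) b p.1 p.2.

Section Lift.
Variables (P : zmodType) (b : M -> N -> P) (bP : balanced b).

Lemma tens_lift_pi s : tens_lift b (tens_pi s) = \sum_(p <- s) b p.1 p.2.
Proof.
have: tens_cong (tens_repr (tens_pi s)) s by apply: tens_reprP.
rewrite /tens_lift; move: (tens_repr _) => t.
elim=> {s t} [//|s t _ -> //|s t u _ -> _ -> //|s s' t t' _ IH1 _ IH2|s t|m
  |m m' n|m n n'|r m n].
- by rewrite !big_cat IH1 IH2.
- by rewrite !big_cat /= addrC.
- rewrite big_seq1 big_nil /=; apply: (addrI (b m 0)).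
  by rewrite -(balancedDr bP) !addr0.
- by rewrite !big_cons !big_nil !addr0 (balancedDl bP).
- by rewrite !big_cons !big_nil !addr0 (balancedDr bP).
- by rewrite !big_seq1 (balancedZ bP).
Qed.

Lemma tens_lift_tmul m n : tens_lift b (tmul m n) = b m n.
Proof. by rewrite tens_lift_pi big_seq1. Qed.

Lemma tens_liftD : {morph tens_lift b : x y / x + y}.
Proof.
move=> x y; rewrite -(tens_reprK x) -(tens_reprK y) [_ + _]tens_addE.
by rewrite !tens_lift_pi big_cat.
Qed.

Lemma tens_lift0 : tens_lift b 0 = 0.
Proof. by apply: (addrI (tens_lift b 0)); rewrite -tens_liftD !addr0. Qed.

End Lift.

Lemma tens_ind (Q : tens -> Prop) :
  Q 0 -> (forall x y, Q x -> Q y -> Q (x + y)) ->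
  (forall m n, Q (tmul m n)) -> forall x, Q x.
Proof.
move=> Q0 QD Qt x; rewrite -(tens_reprK x) tens_pi_sum.
by elim/big_ind: _.
Qed.

End Tensor.

Section TensorMap.
Variables (R S T : comPzRingType).
Variables (f : {rmorphism R -> S}) (h : {rmorphism R -> T}).
Variables (M M' : lmodType R) (N : lmodType S) (N' : lmodType T).

Definition tens_map (u : M -> M') (v : N -> N') : tens f M N -> tens h M' N' :=
  tens_lift (fun m n => tmul h (u m) (v n)).

Lemma tens_map_balanced (u : {linear M -> M'}) (v : {additive N -> N'}) :
  (forall r n, v (f r *: n) = h r *: v n) ->
  balanced f (fun m n => tmul h (u m) (v n)).
Proof.
move=> vZ; split=> [m m' n|m n n'|r m n].
- by rewrite raddfD tmulDl.
- by rewrite raddfD tmulDr.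
- by rewrite linearZ tmul_bal vZ.
Qed.

End TensorMap.

Section TensorLinear.
Variables (R S : comPzRingType) (f : {rmorphism R -> S}).

Section Left.
Variables (M M' : lmodType R) (N : lmodType S) (u : {linear M -> M'}).

Definition tens_mapl : tens f M N -> tens f M' N := tens_map (f := f) f u id.

Let bal : balanced f (fun m (n : N) => tmul f (u m) n).
Proof. exact: (tens_map_balanced u (v := idfun)). Qed.

Lemma tens_mapl_tmul m n : tens_mapl (tmul f m n) = tmul f (u m) n.
Proof. exact: tens_lift_tmul. Qed.

Lemma tens_mapl_is_linear : linear tens_mapl.
Proof.
move=> a x y; rewrite /tens_mapl /tens_map tens_liftD //; congr (_ + _).
elim/tens_ind: x => [|x x' IH IH'|m n].
- by rewrite scaler0 tens_lift0 // scaler0.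
- by rewrite scalerDr !tens_liftD // IH IH' scalerDr.
- by rewrite -tmulZ !tens_lift_tmul // tmulZ.
Qed.

HB.instance Definition _ :=
  GRing.isLinear.Build S (tens f M N) (tens f M' N) _ tens_mapl
    tens_mapl_is_linear.
End Left.

Section Right.
Variables (M : lmodType R) (N N' : lmodType S) (v : {linear N -> N'}).

Definition tens_mapr : tens f M N -> tens f M N' := tens_map (f := f) f id v.

Let bal : balanced f (fun (m : M) n => tmul f m (v n)).
Proof.
apply: (tens_map_balanced (f := f) (h := f) (idfun : {linear M -> M}) (v := v)).
by move=> r n /=; rewrite linearZ.
Qed.

Lemma tens_mapr_tmul m n : tens_mapr (tmul f m n) = tmul f m (v n).
Proof. exact: tens_lift_tmul. Qed.

Lemma tens_mapr_is_linear : linear tens_mapr.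
Proof.
move=> a x y; rewrite /tens_mapr /tens_map tens_liftD //; congr (_ + _).
elim/tens_ind: x => [|x x' IH IH'|m n].
- by rewrite scaler0 tens_lift0 // scaler0.
- by rewrite scalerDr !tens_liftD // IH IH' scalerDr.
- by rewrite -tmulZ !tens_lift_tmul // linearZ tmulZ.
Qed.

HB.instance Definition _ :=
  GRing.isLinear.Build S (tens f M N) (tens f M N') _ tens_mapr
    tens_mapr_is_linear.
End Right.
End TensorLinear.

Arguments tens_mapl {R S} f {M M'} N u x.
Arguments tens_mapr {R S} f M {N N'} v x.
Arguments tens_map {R S T} f h {M M' N N'} u v x.
Arguments tmul {R S} f {M N} m n.

Section TensorFunctoriality.
Variables (R S : comPzRingType) (f : {rmorphism R -> S}).

Lemma tens_additive_ext (M : lmodType R) (N : lmodType S) (P : zmodType)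
    (u v : {additive tens f M N -> P}) :
  (forall m n, u (tmul f m n) = v (tmul f m n)) -> u =1 v.
Proof.
move=> uv x; elim/tens_ind: x => [|x y IHx IHy|//]; first by rewrite !raddf0.
by rewrite !raddfD IHx IHy.
Qed.

Lemma tens_mapl_id (M : lmodType R) (N : lmodType S) (u : {linear M -> M}) :
  u =1 id -> tens_mapl f N u =1 id.
Proof.
move=> uE; apply: (@tens_additive_ext _ _ _ _ idfun) => m n /=.
by rewrite tens_mapl_tmul uE.
Qed.

Lemma tens_mapl_comp (M1 M2 M3 : lmodType R) (N : lmodType S)
    (u : {linear M1 -> M2}) (v : {linear M2 -> M3}) (w : {linear M1 -> M3}) :
  (forall x, w x = v (u x)) ->
  forall x, tens_mapl f N w x = tens_mapl f N v (tens_mapl f N u x).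
Proof.
move=> wE; apply: (@tens_additive_ext _ _ _ _ (_ \o _)) => m n /=.
by rewrite !tens_mapl_tmul wE.
Qed.

Lemma tens_mapl0 (M1 M2 : lmodType R) (N : lmodType S)
    (u : {linear M1 -> M2}) :
  (forall x, u x = 0) -> forall x, tens_mapl f N u x = 0.
Proof.
move=> uE; apply: (@tens_additive_ext _ _ _ _ \0) => m n /=.
by rewrite tens_mapl_tmul uE -[0 in LHS](scale0r 0) tmul_bal rmorph0 tmulZ !scale0r.
Qed.

Lemma tens_maplr (M1 M2 : lmodType R) (N1 N2 : lmodType S)
    (u : {linear M1 -> M2}) (v : {linear N1 -> N2}) x :
  tens_mapl f N2 u (tens_mapr f M1 v x) = tens_mapr f M2 v (tens_mapl f N1 u x).
Proof.
move: x; apply: (@tens_additive_ext _ _ _ (_ \o _) (_ \o _)) => m n /=.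
by rewrite !(tens_mapl_tmul, tens_mapr_tmul).
Qed.

End TensorFunctoriality.

(** [N ⊗_A A'], as an [A']-module. *)
Definition ext_scalars (A A' : comPzRingType) (g : {rmorphism A -> A'})
    (N : lmodType A) : lmodType A' := tens g N A'^o.

(** The morphisms [[p] -> [q]] of the simplex category. *)
Record delta (p q : nat) := Delta {
  delta_fun :> 'I_p.+1 -> 'I_q.+1;
  delta_homo : {homo delta_fun : i j / (i <= j)%N} }.

Lemma delta_ext p q (a b : delta p q) : a =1 b -> a = b.
Proof.
case: a b => [a ha] [b hb] /= /funext ab; case: b / ab hb => hb.
by rewrite (Prop_irrelevance ha hb).
Qed.

Definition delta_id p : delta p p := @Delta p p id (fun i j ij => ij).

Definition delta_comp p q r (b : delta q r) (a : delta p q) : delta p r :=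
  @Delta p r (b \o a) (fun i j ij => delta_homo b (delta_homo a ij)).

Lemma codegen_subproof m (j : 'I_m.+1) (i : 'I_m.+2) : (unbump j i < m.+1)%N.
Proof.
have := ltn_ord j; have := ltn_ord i; rewrite /unbump.
by case: (ltnP j i) => /=; lia.
Qed.

Lemma codegen_homo m (j : 'I_m.+1) :
  {homo (fun i : 'I_m.+2 => Ordinal (codegen_subproof j i))
    : i i' / (i <= i')%N}.
Proof.
move=> i i' /= ii'; rewrite /unbump.
by case: (ltnP j i); case: (ltnP j i') => /=; lia.
Qed.

(** The codegeneracy [σ^j : [m+1] -> [m]], hitting [j] twice. *)
Definition codegen m (j : 'I_m.+1) : delta m.+1 m := Delta (codegen_homo j).

Record cosimplicial (A : comPzRingType) := Cosimplicial {
  cobj :> nat -> lmodType A;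
  cmap : forall p q, delta p q -> {linear cobj p -> cobj q};
  cmap_id : forall p x, cmap (delta_id p) x = x;
  cmap_comp : forall p q r (b : delta q r) (a : delta p q) x,
    cmap (delta_comp b a) x = cmap b (cmap a x) }.

Definition normalization (A : comPzRingType) (X : cosimplicial A) (i : nat) :
    X i -> Prop :=
  match i with
  | 0 => fun=> True
  | m.+1 => fun x => forall j : 'I_m.+1, cmap X (codegen j) x = 0
  end.

Definition finite_dimensional (A : comPzRingType) (X : cosimplicial A) : Prop :=
  exists d : nat, forall i : nat, (d <= i)%N ->
    forall x : X i, normalization x -> x = 0.

Section CosimplicialExt.
Variables (A A' : comPzRingType) (g : {rmorphism A -> A'}).
Variable X : cosimplicial A.

Definition cext_map p q (a : delta p q) :
    {linear ext_scalars g (X p) -> ext_scalars g (X q)} :=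
  tens_mapl g A'^o (cmap X a).

Lemma cext_map_id p x : cext_map (delta_id p) x = x.
Proof. exact/tens_mapl_id/cmap_id. Qed.

Lemma cext_map_comp p q r (b : delta q r) (a : delta p q) x :
  cext_map (delta_comp b a) x = cext_map b (cext_map a x).
Proof. exact/tens_mapl_comp/cmap_comp. Qed.

Definition cosimplicial_ext : cosimplicial A' :=
  Cosimplicial cext_map_id cext_map_comp.

End CosimplicialExt.

(** [tforms k p n] is the degree [n] part of the tensor algebra over
    [k[t_0,..,t_p]] on the symbols [dt_0,..,dt_p]: [x w] is the coefficient of
    [dt_{w_1} ... dt_{w_n}].  [form_ideal] is the degree [n] part of the
    two-sided ideal generated by the relations of graded commutativity
    ([dt_i dt_i = 0] and [dt_i dt_j = - dt_j dt_i]), by [sum_i t_i - 1] and by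
    [sum_i dt_i]. *)
Section Forms.
Variables (k : fieldType) (p : nat).

Definition tforms (n : nat) : Type :=
  {ffun n.-tuple 'I_p.+1 -> {mpoly k[p.+1]}}.
HB.instance Definition _ n := GRing.Lmodule.on (tforms n).

(* [dt_{s_1} ... dt_{s_n}]; this is 0 if [size s != n], so that the sequences
   in the constructors below need no size constraints. *)
Definition dmon n (s : seq 'I_p.+1) : tforms n :=
  [ffun w : n.-tuple 'I_p.+1 => (tval w == s)%:R].

Definition pscale n (c : {mpoly k[p.+1]}) (x : tforms n) : tforms n :=
  [ffun w => c * x w].

Inductive form_ideal_spec (n : nat) : tforms n -> Prop :=
| form_ideal_sumt (x : tforms n) :
    form_ideal_spec (pscale (\sum_(i < p.+1) 'X_i - 1) x)
| form_ideal_sumdt (u v : seq 'I_p.+1) :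
    form_ideal_spec (\sum_(i < p.+1) dmon n (u ++ i :: v))
| form_ideal_sqr (u v : seq 'I_p.+1) (i : 'I_p.+1) :
    form_ideal_spec (dmon n (u ++ i :: i :: v))
| form_ideal_anti (u v : seq 'I_p.+1) (i j : 'I_p.+1) :
    form_ideal_spec (dmon n (u ++ i :: j :: v) + dmon n (u ++ j :: i :: v))
| form_idealD (x y : tforms n) :
    form_ideal_spec x -> form_ideal_spec y -> form_ideal_spec (x + y)
| form_idealM (c : {mpoly k[p.+1]}) (x : tforms n) :
    form_ideal_spec x -> form_ideal_spec (pscale c x).

Lemma form_ideal0 n : @form_ideal_spec n 0.
Proof.
rewrite (_ : 0 = pscale (\sum_(i < p.+1) 'X_i - 1) 0); last first.
  by apply/ffunP=> w; rewrite !ffunE mulr0.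
exact: form_ideal_sumt.
Qed.

Lemma form_idealZ n (a : k) (x : tforms n) :
  form_ideal_spec x -> form_ideal_spec (a *: x).
Proof.
move=> /(form_idealM a%:MP); rewrite (_ : pscale _ _ = a *: x) //.
by apply/ffunP=> w; rewrite !ffunE mul_mpolyC.
Qed.

Definition form_ideal n :=
  Submodule (@form_ideal0 n) (@form_idealD n) (@form_idealZ n).

Definition forms n : lmodType k := mquot (form_ideal n).

(** The de Rham differential
    [d (c dt_{w_1} ... dt_{w_n}) = sum_i (∂c/∂t_i) dt_i dt_{w_1} ... dt_{w_n}]. *)
Definition tforms_d n (x : tforms n) : tforms n.+1 :=
  [ffun w => mderiv (thead w) (x [tuple of behead w])].

Lemma tforms_d_is_linear n : linear (@tforms_d n).
Proof. by move=> a x y; apply/ffunP=> w; rewrite !ffunE linearP. Qed.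

HB.instance Definition _ n :=
  GRing.isLinear.Build k (tforms n) (tforms n.+1) _ (@tforms_d n)
    (@tforms_d_is_linear n).

Lemma tforms_expand n (x : tforms n) :
  x = \sum_(w : n.-tuple 'I_p.+1) pscale (x w) (dmon n w).
Proof.
apply/ffunP=> w; rewrite sum_ffunE (bigD1 w) //= !ffunE eqxx mulr1.
rewrite big1 ?addr0 // => v vw; rewrite !ffunE.
by rewrite (negPf _ : tval w == v = false) ?mulr0 // eq_sym.
Qed.

Lemma tuple_consE n (w : n.+1.-tuple 'I_p.+1) i s :
  (tval w == i :: s) = (thead w == i) && (behead w == s).
Proof. by case/tupleP: w => j w; rewrite theadE /= eqseq_cons. Qed.

Lemma tforms_d_mon n c s :
  tforms_d (pscale c (dmon n s)) =
  \sum_(i < p.+1) pscale (mderiv i c) (dmon n.+1 (i :: s)).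
Proof.
apply/ffunP=> w; rewrite sum_ffunE !ffunE /=.
rewrite (bigD1 (thead w)) //= big1 ?addr0; last first.
  move=> i iw; rewrite !ffunE tuple_consE.
  by rewrite eq_sym (negPf iw) mulr0.
rewrite !ffunE tuple_consE eqxx /=.
by case: eqP => _; rewrite ?mulr1 // !mulr0 raddf0.
Qed.

Lemma pscaleD n c (x y : tforms n) :
  pscale c (x + y) = pscale c x + pscale c y.
Proof. by apply/ffunP=> w; rewrite !ffunE mulrDr. Qed.

Lemma pscaleDl n c c' (x : tforms n) :
  pscale (c + c') x = pscale c x + pscale c' x.
Proof. by apply/ffunP=> w; rewrite !ffunE mulrDl. Qed.

Lemma pscaleA n c c' (x : tforms n) :
  pscale c (pscale c' x) = pscale (c * c') x.
Proof. by apply/ffunP=> w; rewrite !ffunE mulrA. Qed.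

Lemma pscale_sum n c (J : Type) (r : seq J) (P : pred J) (F : J -> tforms n) :
  pscale c (\sum_(i <- r | P i) F i) = \sum_(i <- r | P i) pscale c (F i).
Proof.
elim/big_rec2: _ => [|i y1 y2 _ <-]; last exact: pscaleD.
by apply/ffunP=> w; rewrite !ffunE mulr0.
Qed.

Definition lwedge n (i : 'I_p.+1) (x : tforms n) : tforms n.+1 :=
  [ffun w => if thead w == i then x [tuple of behead w] else 0].

Lemma lwedge_mon n i s : lwedge i (dmon n s) = dmon n.+1 (i :: s).
Proof.
apply/ffunP=> w; rewrite !ffunE tuple_consE /=.
by case: eqP.
Qed.

Lemma lwedgeD n i (x y : tforms n) : lwedge i (x + y) = lwedge i x + lwedge i y.
Proof. by apply/ffunP=> w; rewrite !ffunE; case: ifP; rewrite ?addr0. Qed.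

Lemma lwedge0 n i : lwedge i (0 : tforms n) = 0.
Proof. by apply/ffunP=> w; rewrite !ffunE if_same. Qed.

Lemma lwedge_sum n i (J : Type) (r : seq J) (P : pred J) (F : J -> tforms n) :
  lwedge i (\sum_(j <- r | P j) F j) = \sum_(j <- r | P j) lwedge i (F j).
Proof.
by elim/big_rec2: _ => [|j y1 y2 _ <-]; rewrite ?lwedge0 ?lwedgeD.
Qed.

Lemma lwedge_pscale n i c (x : tforms n) :
  lwedge i (pscale c x) = pscale c (lwedge i x).
Proof. by apply/ffunP=> w; rewrite !ffunE; case: ifP; rewrite ?mulr0. Qed.

Lemma lwedge_ideal n i (x : tforms n) :
  form_ideal n x -> form_ideal n.+1 (lwedge i x).
Proof.
elim=> {x} [x|u v|u v j|u v j j'|x y _ IHx _ IHy|c x _ IHx].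
- rewrite lwedge_pscale; exact: form_ideal_sumt.
- rewrite lwedge_sum.
  under eq_bigr do rewrite lwedge_mon -cat_cons; exact: form_ideal_sumdt.
- rewrite lwedge_mon -cat_cons; exact: form_ideal_sqr.
- rewrite lwedgeD !lwedge_mon -!cat_cons; exact: form_ideal_anti.
- rewrite lwedgeD; exact: form_idealD.
- rewrite lwedge_pscale; exact: form_idealM.
Qed.

Lemma tforms_d_pscale n c (x : tforms n) :
  tforms_d (pscale c x) =
  \sum_(i < p.+1) pscale (mderiv i c) (lwedge i x) + pscale c (tforms_d x).
Proof.
apply/ffunP=> w; rewrite !ffunE sum_ffunE mderivM; congr (_ + _).
rewrite (bigD1 (thead w)) //= big1 ?addr0; last first.
  by move=> i iw; rewrite !ffunE eq_sym (negPf iw) mulr0.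
by rewrite !ffunE eqxx.
Qed.

Lemma tforms_d_const n s : tforms_d (dmon n s) = 0.
Proof. by apply/ffunP=> w; rewrite !ffunE -mpolyC_nat mderivC. Qed.

Lemma tforms_d_ideal n (x : tforms n) :
  form_ideal n x -> form_ideal n.+1 (tforms_d x).
Proof.
have I0 := submodule0 (form_ideal n.+1).
elim=> {x} [x|u v|u v j|u v j j'|x y _ IHx _ IHy|c x Ix IHx].
- rewrite tforms_d_pscale; apply: submoduleD; last exact: form_ideal_sumt.
  have dE i : mderiv i (\sum_(j < p.+1) 'X_j - 1 : {mpoly k[p.+1]}) = 1.
    rewrite raddfB /= raddf_sum /= -{1}mpolyC1 mderivC subr0 (bigD1 i) //=.
    rewrite big1 ?addr0 => [|j ji]; last first.
      by rewrite mderivX mnm1E (negPf ji) scale0r.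
    by rewrite mderivX mnm1E eqxx scale1r -mpolyX0; congr 'X_[_];
       apply/mnmP=> j; rewrite mnmBE subnn mnm0E.
  under eq_bigr do rewrite dE {1}[x]tforms_expand lwedge_sum pscale_sum.
  rewrite exchange_big; apply: submodule_sum => w _ /=.
  under eq_bigr do rewrite lwedge_pscale lwedge_mon pscaleA mul1r -[_ :: _]cat0s.
  by rewrite -pscale_sum; apply/form_idealM/form_ideal_sumdt.
- rewrite raddf_sum /=; apply: submodule_sum => i _.
  by rewrite tforms_d_const.
- by rewrite tforms_d_const.
- by rewrite raddfD /= !tforms_d_const addr0.
- by rewrite raddfD; apply: form_idealD.
- rewrite tforms_d_pscale; apply: submoduleD; last exact: form_idealM.
  by apply: submodule_sum => i _; apply/form_idealM/lwedge_ideal.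
Qed.

Definition forms_d n : {linear forms n -> forms n.+1} :=
  mquot_map (@tforms_d_ideal n).

(* A double sum of terms which is alternating modulo the ideal. *)
Lemma alt_sum_ideal n (r : seq 'I_p.+1) (G : 'I_p.+1 -> 'I_p.+1 -> tforms n) :
  (forall i, form_ideal n (G i i)) ->
  (forall i j, form_ideal n (G i j + G j i)) ->
  form_ideal n (\sum_(i <- r) \sum_(j <- r) G i j).
Proof.
move=> Gii Gij; elim: r => [|a r IH].
  by rewrite big_nil; apply: submodule0.
rewrite big_cons big_cons; under [X in _ + X]eq_bigr do rewrite big_cons.
rewrite big_split /= -addrA [X in _ + X]addrA -big_split /=.
apply: submoduleD => //; apply: submoduleD => //.
by apply: submodule_sum => j _.
Qed.

Lemma forms_dd n x : forms_d n.+1 (forms_d n x) = 0.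
Proof.
rewrite -(mquot_reprK x) /forms_d /= !mquot_mapE; apply/mquot_pi0.
rewrite [mquot_repr x]tforms_expand !raddf_sum /=.
apply: submodule_sum => w _; rewrite tforms_d_mon raddf_sum /=.
under eq_bigr do rewrite tforms_d_mon.
apply: alt_sum_ideal => [i|i j].
  by apply: form_idealM; exact: (form_ideal_sqr _ [::]).
rewrite mderiv_comm -pscaleD addrC.
by apply: form_idealM; exact: (form_ideal_anti _ [::]).
Qed.

End Forms.

(** The simplicial structure: for [a : [p] -> [q]], the pullback
    [a^* : Ω_q -> Ω_p] sends [t_j] to [sum_(a i = j) t_i] and [dt_j] to
    [sum_(a i = j) dt_i]. *)
Section Pullback.
Variables (k : fieldType) (p q : nat) (a : delta p q).

Definition subst_t (c : {mpoly k[q.+1]}) : {mpoly k[p.+1]} :=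
  c \mPo [tuple \sum_(i < p.+1 | a i == j) 'X_i | j < q.+1].

(* The coefficient of [dt_w] in [a^* (dt_s)] is 1 if [a] maps [w] to [s], and
   0 otherwise. *)
Definition tforms_pull n (x : tforms k q n) : tforms k p n :=
  [ffun w : n.-tuple 'I_p.+1 => subst_t (x [tuple of map a w])].

Lemma tforms_pull_is_linear n : linear (@tforms_pull n).
Proof.
by move=> c x y; apply/ffunP=> w; rewrite !ffunE /subst_t linearP.
Qed.

HB.instance Definition _ n :=
  GRing.isLinear.Build k (tforms k q n) (tforms k p n) _ (@tforms_pull n)
    (@tforms_pull_is_linear n).

Lemma tforms_pull_pscale n c (x : tforms k q n) :
  tforms_pull (pscale c x) = pscale (subst_t c) (tforms_pull x).
Proof. by apply/ffunP=> w; rewrite !ffunE /subst_t rmorphM. Qed.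

(* Sum of [G] over all the sequences mapped to [s] by [a]. *)
Fixpoint lift_sum (V : zmodType) (s : seq 'I_q.+1) (G : seq 'I_p.+1 -> V) : V :=
  if s is j :: s' then
    \sum_(i < p.+1 | a i == j) lift_sum s' (fun w => G (i :: w))
  else G [::].

Lemma lift_sum_cat (V : zmodType) s s' (G : seq 'I_p.+1 -> V) :
  lift_sum (s ++ s') G =
  lift_sum s (fun w => lift_sum s' (fun w' => G (w ++ w'))).
Proof. by elim: s G => [//|j s IH] G /=; apply: eq_bigr => i _. Qed.

Lemma lift_sum_ideal n s (G : seq 'I_p.+1 -> tforms k p n) :
  (forall w, form_ideal k p n (G w)) -> form_ideal k p n (lift_sum s G).
Proof.
elim: s G => [|j s IH] G IG //=.
by apply: submodule_sum => i _; apply: IH.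
Qed.

Lemma lift_sumD (V : zmodType) s (G H : seq 'I_p.+1 -> V) :
  lift_sum s (fun w => G w + H w) = lift_sum s G + lift_sum s H.
Proof.
elim: s G H => [//|j s IH] G H /=.
by rewrite -big_split; apply: eq_bigr => i _; apply: IH.
Qed.

Lemma lift_sum0 (V : zmodType) s : lift_sum s (fun=> 0 : V) = 0.
Proof. by elim: s => [//|j s IH] /=; apply: big1. Qed.

Lemma lift_sum_sum (V : zmodType) (J : Type) (r : seq J) (P : pred J) s
    (G : J -> seq 'I_p.+1 -> V) :
  lift_sum s (fun w => \sum_(j <- r | P j) G j w) =
  \sum_(j <- r | P j) lift_sum s (G j).
Proof.
elim: s G => [//|j s IH] G /=.
by rewrite exchange_big; apply: eq_bigr => i _; apply: IH.
Qed.

Lemma lift_sum_indic (V : pzRingType) s (w : seq 'I_p.+1) :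
  lift_sum s (fun w' => (w == w')%:R : V) = (map a w == s)%:R.
Proof.
elim: s w => [|j s IH] [|i w] //=; first by rewrite big1 // => i _; apply: lift_sum0.
rewrite eqseq_cons.
have E i' : lift_sum s (fun w' => (i :: w == i' :: w')%:R : V)
    = (i == i')%:R * (map a w == s)%:R.
  rewrite -IH; case: (eqVneq i i') => [->|ne].
    by rewrite mul1r; congr lift_sum; apply/funext=> w'; rewrite eqseq_cons eqxx.
  rewrite mul0r -[RHS](lift_sum0 V s); congr lift_sum; apply/funext=> w'.
  by rewrite eqseq_cons (negPf ne).
under eq_bigr do rewrite E.
rewrite big_mkcond (bigD1 i) //= big1 ?addr0 => [|i' ne]; last first.
  by rewrite (eq_sym i) (negPf ne) mul0r if_same.
by rewrite eqxx mul1r; case: (a i == j).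
Qed.

Lemma lift_sum_ffun n s (G : seq 'I_p.+1 -> tforms k p n) w :
  lift_sum s G w = lift_sum s (fun w' => G w' w).
Proof.
elim: s G => [//|j s IH] G /=.
by rewrite sum_ffunE; apply: eq_bigr => i _; apply: IH.
Qed.

Lemma tforms_pull_mon n s :
  tforms_pull (dmon k n s) = lift_sum s (dmon k n).
Proof.
apply/ffunP=> w; rewrite lift_sum_ffun !ffunE /= /subst_t rmorph_nat.
rewrite -lift_sum_indic; congr lift_sum; apply/funext=> w'.
by rewrite ffunE.
Qed.

Lemma tforms_pull_ideal n (x : tforms k q n) :
  form_ideal k q n x -> form_ideal k p n (tforms_pull x).
Proof.
elim=> {x} [x|u v|u v j|u v j j'|x y _ IHx _ IHy|c x Ix IHx].
- rewrite tforms_pull_pscale (_ : subst_t _ = \sum_(i < p.+1) 'X_i - 1).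
    exact: form_ideal_sumt.
  rewrite /subst_t rmorphB /= rmorph1 raddf_sum /=; congr (_ - _).
  rewrite [RHS](partition_big a predT) //=; apply: eq_bigr => j _.
  by rewrite comp_mpolyXU -tnth_nth tnth_mktuple.
- rewrite raddf_sum /=.
  under eq_bigr do rewrite tforms_pull_mon lift_sum_cat.
  rewrite -lift_sum_sum; apply: lift_sum_ideal => w /=.
  rewrite (_ : bigop.body _ _ _ =
    \sum_(i < p.+1) lift_sum v (fun w' => dmon k n (w ++ i :: w'))); last first.
    by rewrite [RHS](partition_big a predT).
  rewrite -lift_sum_sum; apply: lift_sum_ideal => w'.
  exact: form_ideal_sumdt.
- rewrite tforms_pull_mon lift_sum_cat; apply: lift_sum_ideal => w /=.
  rewrite -big_filter; under eq_bigr do rewrite -big_filter.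
  apply: alt_sum_ideal => [i|i i'].
    apply: lift_sum_ideal => w'; exact: form_ideal_sqr.
  rewrite -lift_sumD; apply: lift_sum_ideal => w'; exact: form_ideal_anti.
- rewrite raddfD /= !tforms_pull_mon !lift_sum_cat -lift_sumD.
  apply: lift_sum_ideal => w /=.
  rewrite [X in _ + X]exchange_big -big_split; apply: submodule_sum => i _ /=.
  rewrite -big_split; apply: submodule_sum => i' _ /=.
  rewrite -lift_sumD; apply: lift_sum_ideal => w'; exact: form_ideal_anti.
- by rewrite raddfD; apply: form_idealD.
- by rewrite tforms_pull_pscale; apply: form_idealM.
Qed.

Lemma mderiv_subst i c : mderiv i (subst_t c) = subst_t (mderiv (a i) c).
Proof.
pose Q c := mderiv i (subst_t c) = subst_t (mderiv (a i) c).
have QM c1 c2 : Q c1 -> Q c2 -> Q (c1 * c2).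
  rewrite /Q /subst_t rmorphM !mderivM /= => -> ->.
  by rewrite rmorphD /= !rmorphM.
have Q1 : Q 1 by rewrite /Q /subst_t rmorph1 -!mpolyC1 !mderivC rmorph0.
have mX n (j j' : 'I_n.+1) : mderiv j ('X_j' : {mpoly k[n.+1]}) = (j' == j)%:R.
  rewrite mderivX mnm1E; case: eqP => [->|_]; last by rewrite scale0r.
  rewrite scale1r -[RHS]mpolyX0; congr 'X_[_].
  by apply/mnmP=> h; rewrite mnmBE subnn mnm0E.
have QX j : Q 'X_j.
  rewrite /Q /subst_t comp_mpolyXU -tnth_nth tnth_mktuple raddf_sum /=.
  under eq_bigr do rewrite mX.
  rewrite mX rmorph_nat big_mkcond (bigD1 i) //= eqxx big1 ?addr0.
    by rewrite eq_sym; case: eqP.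
  by move=> i' /negPf->; rewrite if_same.
elim/mpolyind: c => [|b m c _ _ IH]; first by rewrite /subst_t !raddf0.
rewrite /subst_t comp_mpolyD comp_mpolyZ !mderivD !mderivZ comp_mpolyD.
rewrite comp_mpolyZ -!/(subst_t _) IH; congr (_ *: _ + _).
suff : Q 'X_[m] by [].
rewrite mpolyXE_id; apply: (big_ind Q) => // j _.
by elim: (m j) => // e IHe; rewrite exprS; apply: QM.
Qed.

Lemma tforms_pull_d n (x : tforms k q n) :
  tforms_d (tforms_pull x) = tforms_pull (tforms_d x).
Proof.
apply/ffunP=> w; rewrite !ffunE mderiv_subst; case/tupleP: w => i w.
rewrite !theadE; congr (subst_t (mderiv _ (x _))).
exact: val_inj.
Qed.

Definition forms_pull n : {linear forms k q n -> forms k p n} :=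
  mquot_map (@tforms_pull_ideal n).

Lemma forms_pull_d n x : forms_d k p n (forms_pull n x) = forms_pull n.+1 (forms_d k q n x).
Proof.
by rewrite -(mquot_reprK x) /forms_d /forms_pull /= !mquot_mapE /= tforms_pull_d.
Qed.

End Pullback.

Record complex (A : comPzRingType) := Complex {
  cterm :> nat -> lmodType A;
  cdiff : forall n, {linear cterm n -> cterm n.+1};
  cdiffK : forall n x, cdiff n.+1 (cdiff n x) = 0 }.

Record chain_map (A : comPzRingType) (C D : complex A) := ChainMap {
  cmor :> forall n, {linear C n -> D n};
  cmorP : forall n x, cmor n.+1 (cdiff C n x) = cdiff D n (cmor n x) }.

Definition chain_iso (A : comPzRingType) (C D : complex A)
    (u : chain_map C D) : Prop :=
  exists v : chain_map D C,
    forall n, cancel (u n) (v n) /\ cancel (v n) (u n).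

Section ComplexExt.
Variables (A A' : comPzRingType) (g : {rmorphism A -> A'}) (C : complex A).

Definition cext_diff n :
    {linear ext_scalars g (C n) -> ext_scalars g (C n.+1)} :=
  tens_mapl g A'^o (cdiff C n).

Lemma cext_diffK n x : cext_diff n.+1 (cext_diff n x) = 0.
Proof.
have dd0 y : 0 = cdiff C n.+1 (cdiff C n y) by rewrite cdiffK.
by rewrite -[LHS](@tens_mapl_comp _ _ g _ _ _ A'^o _ _ \0 dd0) tens_mapl0.
Qed.

Definition complex_ext : complex A' := Complex cext_diffK.

End ComplexExt.

Section ThomSullivan.
Variables (k : fieldType) (A : comPzRingType) (f : {rmorphism k -> A}).
Variable X : cosimplicial A.

Definition ts_compat n (x : forall p, tens f (forms k p n) (X p)) : Prop :=
  forall p q (a : delta p q),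
    tens_mapl f (X q) (forms_pull k a n) (x q) =
    tens_mapr f (forms k p n) (cmap X a) (x p).

Record ts_term n := TSTerm {
  ts_val :> forall p, tens f (forms k p n) (X p);
  ts_valP : ts_compat ts_val }.

Section Term.
Variable n : nat.

HB.instance Definition _ := gen_eqMixin (ts_term n).
HB.instance Definition _ := gen_choiceMixin (ts_term n).

Lemma ts_ext (x y : ts_term n) : (forall p, x p = y p) -> x = y.
Proof.
case: x y => [x xP] [y yP] /= xy.
have {}xy : x = y by apply: functional_extensionality_dep.
by case: y / xy yP => yP; rewrite (Prop_irrelevance xP yP).
Qed.

Lemma ts_zeroP : ts_compat (fun p => 0 : tens f (forms k p n) (X p)).
Proof. by move=> p q a; rewrite !raddf0. Qed.

Lemma ts_addP (x y : ts_term n) : ts_compat (fun p => x p + y p).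
Proof. by move=> p q a; rewrite !raddfD /= !ts_valP. Qed.

Lemma ts_oppP (x : ts_term n) : ts_compat (fun p => - x p).
Proof. by move=> p q a; rewrite !raddfN /= !ts_valP. Qed.

Lemma ts_scaleP c (x : ts_term n) : ts_compat (fun p => c *: x p).
Proof. by move=> p q a; rewrite !linearZ /= !ts_valP. Qed.

Definition ts_zero := TSTerm ts_zeroP.
Definition ts_add x y := TSTerm (ts_addP x y).
Definition ts_opp x := TSTerm (ts_oppP x).
Definition ts_scale c x := TSTerm (ts_scaleP c x).

Lemma ts_addA : associative ts_add.
Proof. by move=> x y z; apply: ts_ext => p /=; rewrite addrA. Qed.

Lemma ts_addC : commutative ts_add.
Proof. by move=> x y; apply: ts_ext => p /=; rewrite addrC. Qed.

Lemma ts_add0 : left_id ts_zero ts_add.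
Proof. by move=> x; apply: ts_ext => p /=; rewrite add0r. Qed.

Lemma ts_addN : left_inverse ts_zero ts_opp ts_add.
Proof. by move=> x; apply: ts_ext => p /=; rewrite addNr. Qed.

HB.instance Definition _ :=
  GRing.isZmodule.Build (ts_term n) ts_addA ts_addC ts_add0 ts_addN.

Lemma ts_scaleA a b x : ts_scale a (ts_scale b x) = ts_scale (a * b) x.
Proof. by apply: ts_ext => p /=; rewrite scalerA. Qed.

Lemma ts_scale1 : left_id 1 ts_scale.
Proof. by move=> x; apply: ts_ext => p /=; rewrite scale1r. Qed.

Lemma ts_scaleDr : right_distributive ts_scale +%R.
Proof. by move=> a x y; apply: ts_ext => p /=; rewrite scalerDr. Qed.

Lemma ts_scaleDl x : {morph ts_scale^~ x : a b / a + b}.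
Proof. by move=> a b; apply: ts_ext => p /=; rewrite scalerDl. Qed.

HB.instance Definition _ := GRing.Zmodule_isLmodule.Build A (ts_term n)
  ts_scaleA ts_scale1 ts_scaleDr ts_scaleDl.

End Term.

Lemma ts_dP n (x : ts_term n) :
  ts_compat (fun p => tens_mapl f (X p) (forms_d k p n) (x p)).
Proof.
move=> p q a; rewrite -tens_maplr -ts_valP.
rewrite -(tens_mapl_comp (w := forms_pull k a n.+1 \o forms_d k q n)) //.
rewrite -(tens_mapl_comp (w := forms_pull k a n.+1 \o forms_d k q n)) //.
by move=> y /=; rewrite forms_pull_d.
Qed.

Definition ts_d n (x : ts_term n) : ts_term n.+1 := TSTerm (ts_dP x).

Lemma ts_d_is_linear n : linear (@ts_d n).
Proof. by move=> c x y; apply: ts_ext => p /=; rewrite linearP. Qed.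

HB.instance Definition _ n :=
  GRing.isLinear.Build A (ts_term n) (ts_term n.+1) _ (@ts_d n)
    (@ts_d_is_linear n).

Lemma ts_dd n (x : ts_term n) : ts_d (ts_d x) = 0.
Proof.
apply: ts_ext => p /=; rewrite -(tens_mapl_comp (w := \0)) ?tens_mapl0 //.
by move=> y /=; rewrite forms_dd.
Qed.

Definition thom_sullivan : complex A := Complex ts_dd.

End ThomSullivan.

Section BaseChange.
Variables (k : fieldType) (A A' : comPzRingType).
Variables (f : {rmorphism k -> A}) (g : {rmorphism A -> A'}).
Variable X : cosimplicial A.

Let f' : {rmorphism k -> A'} := g \o f.

Definition ext_unit (N : lmodType A) (x : N) : ext_scalars g N :=
  tmul g x (1 : A'^o).

(** The map [M ⊗_k N -> M ⊗_k (N ⊗_A A')] induced by [N -> N ⊗_A A']. *)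
Definition tens_ext (M : lmodType k) (N : lmodType A) :
    tens f M N -> tens f' M (ext_scalars g N) :=
  tens_map f f' id (@ext_unit N).

Lemma ext_unitZ (N : lmodType A) a (x : N) :
  ext_unit (a *: x) = g a *: ext_unit x.
Proof. by rewrite /ext_unit tmul_bal tmulZ. Qed.

Lemma tens_ext_balanced (M : lmodType k) (N : lmodType A) :
  balanced f (fun (m : M) (x : N) => tmul f' m (ext_unit x)).
Proof.
split=> [m m' x|m x y|r m x]; first exact: tmulDl.
  by rewrite /ext_unit tmulDl; apply: tmulDr.
by rewrite tmul_bal ext_unitZ.
Qed.

Lemma tens_ext_tmul (M : lmodType k) (N : lmodType A) (m : M) (x : N) :
  tens_ext (tmul f m x) = tmul f' m (ext_unit x).
Proof. exact/tens_lift_tmul/tens_ext_balanced. Qed.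

Lemma tens_ext_is_additive (M : lmodType k) (N : lmodType A) :
  {morph @tens_ext M N : x y / x + y}.
Proof. exact/tens_liftD/tens_ext_balanced. Qed.

Lemma tens_ext0 (M : lmodType k) (N : lmodType A) : @tens_ext M N 0 = 0.
Proof. exact/tens_lift0/tens_ext_balanced. Qed.

Lemma tens_extZ (M : lmodType k) (N : lmodType A) a (x : tens f M N) :
  tens_ext (a *: x) = g a *: tens_ext x.
Proof.
elim/tens_ind: x => [|x y IHx IHy|m x].
- by rewrite scaler0 tens_ext0 scaler0.
- by rewrite scalerDr !tens_ext_is_additive IHx IHy scalerDr.
- by rewrite -tmulZ !tens_ext_tmul ext_unitZ tmulZ.
Qed.

Lemma tens_ext_mapl (M M' : lmodType k) (N : lmodType A)
    (u : {linear M -> M'}) (x : tens f M N) :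
  tens_ext (tens_mapl f N u x) =
  tens_mapl f' (ext_scalars g N) u (tens_ext x).
Proof.
elim/tens_ind: x => [|x y IHx IHy|m x].
- by rewrite raddf0 !tens_ext0 raddf0.
- by rewrite raddfD !tens_ext_is_additive raddfD /= IHx IHy.
- by rewrite tens_mapl_tmul !tens_ext_tmul tens_mapl_tmul.
Qed.

Lemma tens_ext_mapr (M : lmodType k) (N N' : lmodType A)
    (v : {linear N -> N'}) (v' : {linear ext_scalars g N -> ext_scalars g N'})
    (x : tens f M N) :
  (forall y, v' (ext_unit y) = ext_unit (v y)) ->
  tens_ext (tens_mapr f M v x) = tens_mapr f' M v' (tens_ext x).
Proof.
move=> vv'; elim/tens_ind: x => [|x y IHx IHy|m x].
- by rewrite raddf0 !tens_ext0 raddf0.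
- by rewrite raddfD !tens_ext_is_additive raddfD /= IHx IHy.
- by rewrite tens_mapr_tmul !tens_ext_tmul tens_mapr_tmul vv'.
Qed.

Lemma ts_extendP n (x : ts_term f X n) :
  @ts_compat _ _ f' (cosimplicial_ext g X) n (fun p => tens_ext (x p)).
Proof.
move=> p q a; rewrite -tens_ext_mapl ts_valP.
by apply: tens_ext_mapr => y; apply: tens_mapl_tmul.
Qed.

(** The map [Ω^n(X) -> Ω^n(X ⊗_A A')] induced by [X -> X ⊗_A A']. *)
Definition ts_extend n (x : ts_term f X n) :
    ts_term f' (cosimplicial_ext g X) n :=
  TSTerm (ts_extendP x).

Definition base_change_fun n :
    ext_scalars g (thom_sullivan f X n) ->
    thom_sullivan f' (cosimplicial_ext g X) n :=
  tens_lift (fun (x : ts_term f X n) (a : A'^o) => (a : A') *: ts_extend x).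

Lemma base_change_balanced n :
  balanced g
    (fun (x : ts_term f X n) (a : A'^o) => (a : A') *: ts_extend x).
Proof.
split=> [x y a|x a b|r x a].
- by apply: ts_ext => p /=; rewrite tens_ext_is_additive scalerDr.
- by rewrite scalerDl.
- by apply: ts_ext => p /=; rewrite tens_extZ scalerA mulrC.
Qed.

Lemma base_change_tmul n (x : ts_term f X n) (a : A'^o) :
  base_change_fun (tmul g x a) = (a : A') *: ts_extend x.
Proof. exact/tens_lift_tmul/base_change_balanced. Qed.

Lemma base_change_is_linear n : linear (@base_change_fun n).
Proof.
have bP := base_change_balanced n.
move=> c x y; rewrite /base_change_fun tens_liftD //; congr (_ + _).
elim/tens_ind: x => [|x x' IH IH'|x a].
- by rewrite scaler0 tens_lift0 // scaler0.
- by rewrite scalerDr !tens_liftD // IH IH' scalerDr.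
- by rewrite -tmulZ !tens_lift_tmul // scalerA.
Qed.

HB.instance Definition _ n :=
  GRing.isLinear.Build A' (ext_scalars g (thom_sullivan f X n))
    (thom_sullivan f' (cosimplicial_ext g X) n) _ (@base_change_fun n)
    (@base_change_is_linear n).

Lemma base_change_d n (x : complex_ext g (thom_sullivan f X) n) :
  base_change_fun (cdiff (complex_ext g (thom_sullivan f X)) n x) =
  cdiff (thom_sullivan f' (cosimplicial_ext g X)) n (base_change_fun x).
Proof.
move: x; apply: (@tens_additive_ext _ _ _ _ _ _
  (@base_change_fun n.+1 \o cext_diff g (thom_sullivan f X) n)
  (@ts_d _ _ f' (cosimplicial_ext g X) n \o @base_change_fun n)) => x a /=.
rewrite tens_mapl_tmul !base_change_tmul linearZ /=; congr (_ *: _).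
by apply: ts_ext => p /=; rewrite tens_ext_mapl.
Qed.

(** In degree [n], [x ⊗ a'] goes to the family of the [a' (1 ⊗ i)(x_p)], where
    [i : X^p -> X^p ⊗_A A'] is [y |-> y ⊗ 1]. *)
Definition base_change :
    chain_map (complex_ext g (thom_sullivan f X))
              (thom_sullivan f' (cosimplicial_ext g X)) :=
  @ChainMap A' (complex_ext g (thom_sullivan f X))
    (thom_sullivan f' (cosimplicial_ext g X))
    (fun n => @base_change_fun n) base_change_d.

End BaseChange.

(* Main.v *)
Require Import Defs.
From HB Require Import structures.
From mathcomp Require Import all_boot all_order all_algebra.
From mathcomp Require Import boolp mpoly zify.

(** Write [E(X)] for the module of compatible families in degree [n].  For each
    [m] there is a map [e_m : Ω_m ⊗ X^m -> E(X)], natural in [X], such that if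
    [x] in [E(X)] vanishes in cosimplicial degrees [< m] then so does
    [e_m(x_m)], and [e_m(x_m)] agrees with [x] in degree [m].  Hence the
    operators [T_m(x) = e_m(x_m)] satisfy [(1 - T_{d-1}) ... (1 - T_0) = 0] as
    soon as [N^q(X) = 0] for [q >= d], since a family vanishing in degrees [< d]
    is then zero.  The same holds for [X' = X ⊗_A A'], because [N^q] is the
    image of a natural idempotent [normal_proj].  So the identity of [E] factors
    through finitely many of the functors [X |-> Ω_m ⊗ X^m], which commute with
    base change.

    To build [e_m], let [t_c : [q] -> [m+1]] count, for cuts [c_0,..,c_m] of
    [[q]], those below a given point.  For an increasing [i : [m] -> [q]] let
    [u_i] be the sum over all choices of [c_l] in [{i_l, i_l + 1}], with the
    sign of the number of [c_l = i_l], of the pullbacks [t_c^*].  By telescoping,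
    [b^* u_i] is the sum of the [u_{i'}] with [b i' = i], so that
    [y |-> sum_i (u_i ⊗ X(i))(y)] sends [Ω_{m+1} ⊗ N^m(X)] to compatible families
    ([spread]).  In degree [m] only [i = id] contributes, and its value on an
    element with vanishing faces of codimension 2 is the boundary, up to sign;
    composing with [cone], a right inverse of the boundary, gives
    [e_m]. *)

Set Implicit Arguments.
Unset Strict Implicit.
Unset Printing Implicit Defensive.

Import GRing.Theory.

Local Open Scope ring_scope.

(** * Idempotent endomorphisms of simplices *)

Section Collapse.
Variable m : nat.

Definition collapse_fun (i : nat) (x : 'I_m.+1) : 'I_m.+1 :=
  if x == i.+1 :> nat then inord i else x.

Lemma collapse_funE i x :
  collapse_fun i x = (if x == i.+1 :> nat then i else x) :> nat.
Proof.
rewrite /collapse_fun; case: eqP => // xi; rewrite inordK //.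
by have := ltn_ord x; lia.
Qed.

Lemma collapse_homo i : {homo collapse_fun i : x y / (x <= y)%N}.
Proof. by move=> x y xy; rewrite !collapse_funE; do 2 case: eqP; lia. Qed.

(** The endomorphism [δ^{i+1} σ^i] of [[m]], sending [i+1] to [i] and fixing
    everything else; it is the identity if [i >= m]. *)
Definition collapse i : delta m m := Delta (collapse_homo i).

(** The hypothesis quantifies over elements of values [i] and [i+1], hence is vacuous for [i >= m],
    where [collapse] is the identity. *)
Lemma collapse_absorb q (a : delta m q) i :
  (forall x y : 'I_m.+1, x = i :> nat -> y = i.+1 :> nat -> a x = a y) ->
  delta_comp a (collapse i) = a.
Proof.
move=> ai; apply: delta_ext => x /=; case: (x =P i.+1 :> nat) => xi.
  by apply: ai => //; rewrite collapse_funE xi eqxx.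
by congr (a _); apply: val_inj; rewrite /= collapse_funE; case: eqP.
Qed.

End Collapse.

(** Hence whatever [collapse] kills is killed by the codegeneracy; [collapse_factor] gives the
    converse. *)
Lemma codegen_collapse m (i : 'I_m.+1) :
  delta_comp (codegen i) (collapse m.+1 i) = codegen i.
Proof.
apply: collapse_absorb => x y xi yi; apply: val_inj => /=.
by rewrite xi yi /unbump; lia.
Qed.

Lemma lift_homo m (j : 'I_m.+1) :
  {homo (lift j : 'I_m -> 'I_m.+1) : x y / (x <= y)%N}.
Proof. by move=> x y xy; rewrite /= /bump; lia. Qed.

Definition coface m (j : 'I_m.+2) : delta m m.+1 := Delta (@lift_homo m.+1 j).

Lemma collapse_factor m (i : 'I_m.+1) :
  collapse m.+1 i = delta_comp (coface (lift ord0 i)) (codegen i).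
Proof.
apply: delta_ext => x; apply: val_inj => /=.
rewrite collapse_funE /bump /unbump /=.
by case: eqP; lia.
Qed.

(** * Strictly increasing maps *)

Definition increasing m q (i : 'I_m.+1 -> 'I_q.+1) : bool :=
  [forall x : 'I_m.+1, forall y : 'I_m.+1, (x < y)%N ==> (i x < i y)%N].

Lemma increasingP m q (i : 'I_m.+1 -> 'I_q.+1) :
  reflect {homo i : x y / (x < y)%N} (increasing i).
Proof.
apply: (iffP 'forall_forallP) => [ii x y xy|ii x y].
  by have /implyP := ii x y; apply.
by apply/implyP/ii.
Qed.

Lemma increasing_homo m q (i : 'I_m.+1 -> 'I_q.+1) :
  increasing i -> {homo i : x y / (x <= y)%N}.
Proof.
move=> /increasingP ii x y; rewrite leq_eqVlt => /predU1P[/val_inj->//|/ii].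
exact: ltnW.
Qed.

Lemma increasing_gap m q (i : 'I_m.+1 -> 'I_q.+1) (x y : 'I_m.+1) :
  increasing i -> (x <= y)%N -> (i x + (y - x) <= i y)%N.
Proof.
move=> /increasingP ii; case: y => y ym /=; elim: y ym => [|y IH] ym xy.
  rewrite (_ : x = Ordinal ym) ?subn0 ?addn0 //.
  by apply: val_inj => /=; lia.
case: (ltngtP x y.+1) => [xy'||xy']; [|lia|]; last first.
  rewrite xy' subnn addn0 (_ : x = Ordinal ym) //; exact: val_inj.
have ym' : (y < m.+1)%N by lia.
have := IH ym' ltac:(lia).
have := ii (Ordinal ym') (Ordinal ym) (ltnSn _); lia.
Qed.

Lemma increasing_dim m q (i : 'I_m.+1 -> 'I_q.+1) : increasing i -> (m <= q)%N.
Proof.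
move=> /(@increasing_gap _ _ _ ord0 ord_max) /(_ isT) /=.
have := ltn_ord (i ord_max); lia.
Qed.

Lemma increasing_id m (i : 'I_m.+1 -> 'I_m.+1) : increasing i -> i =1 id.
Proof.
move=> ii x; apply: val_inj => /=.
have := increasing_gap ii (leq0n x : (ord0 <= x)%N).
have := increasing_gap ii (leq_ord x : (x <= ord_max)%N).
by have := ltn_ord (i ord_max); have := ltn_ord x; rewrite /=; lia.
Qed.

(** Where strictness fails, monotonicity makes [a] constant on an interval from [x] to some [y > x],
    in particular on [x] and [x+1]. *)
Lemma nonincreasing_absorb m q (a : delta m q) : ~~ increasing a ->
  exists2 i : nat, (i < m)%N & delta_comp a (collapse m i) = a.
Proof.
move=> /forallPn[x /forallPn[y]]; rewrite negb_imply -leqNgt => /andP[xy yx].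
exists x; first by have := ltn_ord y; lia.
apply: collapse_absorb => x' y' xx' yx'; apply/val_inj/eqP.
rewrite (_ : x' = x); last exact: val_inj.
have xy' : (x <= y')%N by lia.
have yy' : (y' <= y)%N by lia.
have := delta_homo a xy'; have := delta_homo a yy'; rewrite /=; lia.
Qed.

(** The constant map is a dummy value that makes this total, for use in sums filtered by
    [increasing]. *)
Definition delta_of m q (i : 'I_m.+1 -> 'I_q.+1) : delta m q :=
  if pselect {homo i : x y / (x <= y)%N} is left h then Delta h
  else @Delta m q (fun=> ord0) (fun _ _ _ => leqnn 0).

Lemma delta_ofE m q (i : 'I_m.+1 -> 'I_q.+1) :
  increasing i -> delta_of i =1 i.
Proof.
by move=> /increasing_homo ih; rewrite /delta_of; case: pselect.
Qed.

Lemma sum_ltn n x : (x <= n)%N -> (\sum_(y < n) (y < x) = x)%N.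
Proof.
elim: n x => [|n IH] x xn; first by rewrite big_ord0; lia.
rewrite big_ord_recr /=; case: (ltngtP x n.+1) xn => // [xn|->] _.
  by rewrite IH; lia.
rewrite (eq_bigr (fun y : 'I_n => nat_of_bool (y < n)%N)); last first.
  by move=> y _; rewrite /= ltn_ord leqW // ltn_ord.
by rewrite IH // addn1.
Qed.

(** * Cuts and their pullback *)

Section Cuts.

Lemma cut_map_subproof m q (j : 'I_m.+1 -> 'I_q.+2) (x : 'I_q.+1) :
  (\sum_(l < m.+1) (j l <= x) < m.+2)%N.
Proof.
rewrite ltnS -[leqRHS]card_ord -sum1_card; apply: leq_sum => l _.
exact: leq_b1.
Qed.

Lemma cut_map_homo m q (j : 'I_m.+1 -> 'I_q.+2) :
  {homo (fun x => Ordinal (cut_map_subproof j x)) : x y / (x <= y)%N}.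
Proof.
move=> x y xy; apply: leq_sum => l _; case: (leqP _ x) => //= jx.
by rewrite (leq_trans jx xy).
Qed.

(** A value [c] of [j] is the cut of [[q]] into [[0,c[] and [[c,q]]; the map
    counts the cuts below [x]. *)
Definition cut_map m q (j : 'I_m.+1 -> 'I_q.+2) : delta q m.+1 :=
  Delta (@cut_map_homo m q j).

Variables (p q : nat) (b : delta p q).

Lemma pull_cut_subproof (c : 'I_q.+2) :
  (\sum_(x < p.+1) (b x < c) < p.+2)%N.
Proof.
rewrite ltnS -[leqRHS]card_ord -sum1_card; apply: leq_sum => l _.
exact: leq_b1.
Qed.

Definition pull_cut (c : 'I_q.+2) : 'I_p.+2 := Ordinal (pull_cut_subproof c).

(** Since [b] is monotone, the preimage of the initial segment [[0,c[] is again an initial segment,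
    hence determined by its size. *)
Lemma pull_cut_leq c (x : 'I_p.+1) : (pull_cut c <= x)%N = (c <= b x)%N.
Proof.
rewrite /= leqNgt [RHS]leqNgt; congr negb; apply/idP/idP; last first.
  move=> bxc; rewrite -(@sum_ltn p.+1 x.+1) //.
  apply: leq_sum => y _; rewrite ltnS; case: (leqP y x) => //= yx.
  by rewrite (leq_ltn_trans (delta_homo b yx)).
apply: contraLR; rewrite -!leqNgt => cbx.
rewrite -[leqRHS](@sum_ltn p.+1 x (ltnW (ltn_ord x))).
apply: leq_sum => y _; case: (ltnP y x) => [_|xy]; first exact: leq_b1.
by rewrite ltnNge (leq_trans cbx) //; apply: delta_homo.
Qed.

Lemma cut_map_comp m (j : 'I_m.+1 -> 'I_q.+2) :
  delta_comp (cut_map j) b = cut_map (pull_cut \o j).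
Proof.
apply: delta_ext => x; apply: val_inj => /=; apply: eq_bigr => l _.
by rewrite -pull_cut_leq.
Qed.

End Cuts.

(** * Signed weights of cuts *)

Section CutWeights.
Variable R : comPzRingType.

Definition cut_below q (i : 'I_q.+1) : 'I_q.+2 := widen_ord (leqnSn _) i.
Definition cut_above q (i : 'I_q.+1) : 'I_q.+2 := lift ord0 i.

(** The point [i] is viewed as the edge joining the cuts [i] and [i+1]; this is the coefficient of
    [c] in its boundary. *)
Definition cut_weight q (i : 'I_q.+1) (c : 'I_q.+2) : R :=
  (c == cut_above i)%:R - (c == cut_below i)%:R.

(** The fibre of [b] over [i] is an interval, possibly empty, so the boundaries of its edges
    telescope to the difference of its two end cuts. *)
Lemma sum_cut_weight p q (b : delta p q) (i : 'I_q.+1) (c : 'I_p.+2) :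
  \sum_(i' | b i' == i) cut_weight i' c =
  \sum_(c' | pull_cut b c' == c) cut_weight i c'.
Proof.
set lo := pull_cut b (cut_below i); set hi := pull_cut b (cut_above i).
have sum_eq (c0 : 'I_q.+2) : \sum_(c' | pull_cut b c' == c) (c' == c0)%:R =
    (c == pull_cut b c0)%:R :> R.
  rewrite big_mkcond (bigD1 c0) //= eqxx big1 ?addr0.
    by rewrite eq_sym; case: eqP.
  by move=> c' /negPf->; rewrite if_same.
rewrite [RHS]sumrB !sum_eq -/lo -/hi.
(* By the adjunction [pull_cut_leq], the fibre lies between the pullbacks of the two cuts adjacent
   to [i]. *)
have bE (i' : 'I_p.+1) : (b i' == i) = (lo <= i' < hi)%N.
  rewrite ltnNge !pull_cut_leq /= /bump /=; apply/eqP/idP => [->|]; first lia.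
  by move=> h; apply: val_inj => /=; lia.
pose F (x : nat) : R := (c == x :> nat)%:R.
rewrite (eq_big (fun i' : 'I_p.+1 => (lo <= i' < hi)%N)
  (fun i' : 'I_p.+1 => F i'.+1 - F i')) => [|i'|i' _]; [|exact: bE|]; last first.
  by rewrite /cut_weight /F -!val_eqE /= /bump /=.
have lohi : (lo <= hi)%N.
  by apply: leq_sum => x _; rewrite /= /bump /=; lia.
have hip : (hi <= p.+1)%N by rewrite -ltnS ltn_ord.
transitivity (\sum_(lo <= x < hi) (F x.+1 - F x)); last first.
  by rewrite telescope_sumr // /F -!val_eqE.
rewrite (big_nat_widen _ _ p.+1) // big_geq_mkord.
by apply: eq_bigl => x; rewrite andbC.
Qed.

Definition cuts_weight m q (i : {ffun 'I_m.+1 -> 'I_q.+1})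
    (j : {ffun 'I_m.+1 -> 'I_q.+2}) : R :=
  \prod_l cut_weight (i l) (j l).

(** Distributing products over sums on both sides reduces this to a single cut. *)
Lemma sum_cuts_weight m p q (b : delta p q) (i : {ffun 'I_m.+1 -> 'I_q.+1})
    (j : {ffun 'I_m.+1 -> 'I_p.+2}) :
  \sum_(i' : {ffun 'I_m.+1 -> 'I_p.+1} | [ffun l => b (i' l)] == i)
     cuts_weight i' j =
  \sum_(j' : {ffun 'I_m.+1 -> 'I_q.+2} | [ffun l => pull_cut b (j' l)] == j)
     cuts_weight i j'.
Proof.
transitivity (\prod_l \sum_(i' | b i' == i l) cut_weight i' (j l)).
  rewrite bigA_distr_big_dep; apply: eq_bigl => i'; apply/eqP/familyP.
    by move=> <- l; apply/eqP; rewrite ffunE.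
  by move=> h; apply/ffunP => l; rewrite ffunE; apply/eqP/(h l).
under eq_bigr do rewrite sum_cut_weight.
rewrite bigA_distr_big_dep; apply: eq_bigl => j'; apply/familyP/eqP.
  by move=> h; apply/ffunP => l; rewrite ffunE; apply/eqP/(h l).
by move=> <- l; apply/eqP; rewrite ffunE.
Qed.

End CutWeights.

(** * Cuts adjacent to the identity *)

Section FaceCuts.
Variables (R : comPzRingType) (m : nat).

Definition id_cuts : {ffun 'I_m.+1 -> 'I_m.+1} := [ffun l => l].

(** The cuts whose [cut_map] is the coface skipping [r]. *)
Definition face_cuts (r : 'I_m.+1) : {ffun 'I_m.+1 -> 'I_m.+2} :=
  [ffun l : 'I_m.+1 => if (l < r)%N then cut_above l else cut_below l].

Lemma cuts_weight_id_neq0 j : cuts_weight R id_cuts j != 0 ->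
  forall l : 'I_m.+1, j l = l :> nat \/ j l = l.+1 :> nat.
Proof.
move=> wj l; case: (j l =P l :> nat) => j0; [by left|right].
apply/eqP; apply: contraNT wj => j1; move/eqP: j0 => j0.
rewrite /cuts_weight (bigD1 l) //= /cut_weight ffunE -!val_eqE /= /bump /=.
by rewrite add1n (negPf j0) (negPf j1) subrr mul0r.
Qed.

(** A cut of index [l < x] is at most [x], one of index [l > x] exceeds [x]; only the cut of index
    [x] is in doubt. *)
Lemma cut_mapE (j : 'I_m.+1 -> 'I_m.+2) (x : 'I_m.+1) :
  (forall l : 'I_m.+1, j l = l :> nat \/ j l = l.+1 :> nat) ->
  cut_map j x = (x + (j x == x :> nat))%N :> nat.
Proof.
move=> jl /=; rewrite -[X in (X + _)%N](@sum_ltn m.+1 x) 1?ltnW //.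
rewrite (bigD1 x) //= [X in (X + _)%N = _](_ : _ = (j x == x :> nat) :> nat); last first.
  by case: (jl x) => ->; lia.
rewrite addnC [X in _ = (X + _)%N](bigD1 x) //= ltnn add0n; congr addn.
apply: eq_bigr => l lx; have : l != x :> nat by [].
by case: (jl l) => ->; lia.
Qed.

(** Exactly the [m+1-r] indices [l >= r] contribute a factor [-1]. *)
Lemma cuts_weight_face r :
  cuts_weight R id_cuts (face_cuts r) = (-1) ^+ (m.+1 - r).
Proof.
have -> : (m.+1 - r)%N = (\sum_(l < m.+1) (r <= l))%N.
  apply/eqP; rewrite -(eqn_add2l r) subnKC; last exact/ltnW/ltn_ord.
  rewrite -[X in (X + _)%N](@sum_ltn m.+1 r (ltnW (ltn_ord r))) -big_split /=.
  rewrite -[X in X == _]card_ord -sum1_card; apply/eqP/eq_bigr => l _.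
  by case: ltnP.
rewrite expr_sum; apply: eq_bigr => l _.
rewrite /cut_weight !ffunE; case: ltnP => _; rewrite eqxx -val_eqE /= /bump /= add1n.
  by rewrite gtn_eqF // subr0.
by rewrite ltn_eqF // sub0r.
Qed.

Lemma face_cuts_id (l r : 'I_m.+1) :
  face_cuts r l = l :> nat \/ face_cuts r l = l.+1 :> nat.
Proof. by rewrite ffunE; case: ltnP => _; rewrite /= /bump /=; [right|left]. Qed.

Lemma cut_map_face r x :
  cut_map (face_cuts r) x = (x + (r <= x))%N :> nat.
Proof.
rewrite cut_mapE => [|l]; last exact: face_cuts_id.
congr addn; rewrite ffunE; case: ltnP => _; rewrite /= /bump /=; lia.
Qed.

Lemma codegen_cut_map_face r :
  delta_comp (codegen r) (cut_map (face_cuts r)) = delta_id m.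
Proof.
apply: delta_ext => x; apply: val_inj.
by rewrite -[LHS]/(unbump r (cut_map (face_cuts r) x)) cut_map_face /unbump /=; lia.
Qed.

(** The sections of [codegen r] are the cofaces skipping [r] or [r+1], and only the first takes the
    value [r+1]. Adjacency to the identity then recovers the cuts from the map. *)
Lemma face_cuts_unique (j : {ffun 'I_m.+1 -> 'I_m.+2}) r x :
  cuts_weight R id_cuts j != 0 ->
  delta_comp (codegen r) (cut_map j) =1 id ->
  cut_map j x = lift ord0 r -> j = face_cuts r.
Proof.
move=> /cuts_weight_id_neq0 jl jid jx.
have jE y := cut_mapE y jl.
have jid' y : unbump r (cut_map j y) = y by have := congr1 val (jid y).
have xr : x = r by apply: val_inj; have := jid' x; rewrite jx /= /unbump /bump /=; lia.
apply/ffunP => l; apply: val_inj; rewrite ffunE (fun_if val) /= /bump /=.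
have := jid' l; have := jE l.
have := jx; move/(congr1 val); rewrite xr /= /bump /= => jr.
have jrl : (r <= l)%N -> (cut_map j r <= cut_map j l)%N by apply: delta_homo.
move: jr jrl; rewrite -/(cut_map j r) /=.
rewrite /unbump; case: (jl l) => ->; case: (ltnP l r); lia.
Qed.

End FaceCuts.

(** * Functoriality of forms and multiplication by functions *)

Section FormsFunctor.
Variable k : fieldType.

Lemma subst_tX p q (a : delta p q) j :
  subst_t a ('X_j : {mpoly k[q.+1]}) = \sum_(i | a i == j) 'X_i.
Proof. by rewrite /subst_t comp_mpolyXU -tnth_nth tnth_mktuple. Qed.

Lemma mpoly_rmorph_ext n (R : pzRingType) (u v : {rmorphism {mpoly k[n]} -> R}) :
  (forall c, u c%:MP = v c%:MP) -> (forall i, u 'X_i = v 'X_i) -> u =1 v.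
Proof.
move=> uvC uvX; elim/mpolyind=> [|c m x _ _ IH]; first by rewrite !raddf0.
rewrite !rmorphD IH -mul_mpolyC !rmorphM uvC mpolyXE_id !rmorph_prod.
by congr (_ * _ + _); apply: eq_bigr => i _; rewrite !rmorphXn uvX.
Qed.

(** Both sides are ring morphisms, so it suffices to compare them on variables, where the fibre of
    the composite splits into fibres of [a]. *)
Lemma subst_t_comp p q r (b : delta q r) (a : delta p q)
    (c : {mpoly k[r.+1]}) :
  subst_t (delta_comp b a) c = subst_t a (subst_t b c).
Proof.
move: c; apply: (@mpoly_rmorph_ext _ _
  (comp_mpoly _) (comp_mpoly _ \o comp_mpoly _)) => [c|j] /=.
  by rewrite !comp_mpolyC.
have X l (d : delta l r) := @subst_tX l r d j.
rewrite /subst_t in X; rewrite (X p (delta_comp b a)) X raddf_sum /=.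
rewrite (partition_big a (fun i => b i == j)) //=.
apply: eq_bigr => i bi; rewrite -[RHS]/(subst_t a _) subst_tX.
by apply: eq_bigl => x /=; apply: andb_idl => /eqP->.
Qed.

Lemma subst_t_id p (c : {mpoly k[p.+1]}) : subst_t (delta_id p) c = c.
Proof.
rewrite /subst_t -[RHS]comp_mpoly_id; congr comp_mpoly.
by apply: eq_mktuple => i; rewrite big_pred1_eq.
Qed.

Variable n : nat.

Lemma forms_pull_comp p q r (b : delta q r) (a : delta p q) x :
  forms_pull k (delta_comp b a) n x = forms_pull k a n (forms_pull k b n x).
Proof.
rewrite -(mquot_reprK x) /forms_pull /= !mquot_mapE; congr mquot_pi.
apply/ffunP=> w; rewrite !ffunE subst_t_comp.
rewrite (_ : [tuple of map (delta_comp b a) w] = [tuple of map b (map a w)]) //.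
by apply: val_inj; rewrite /= -map_comp.
Qed.

Lemma forms_pull_id p x : forms_pull k (delta_id p) n x = x.
Proof.
rewrite -[RHS](mquot_reprK x) -{1}(mquot_reprK x) /forms_pull /= !mquot_mapE.
congr mquot_pi; apply/ffunP=> w; rewrite !ffunE subst_t_id.
rewrite (_ : [tuple of map (delta_id p) w] = w) //.
by apply: val_inj; rewrite /= map_id.
Qed.

Section Multiplication.
Variables (p : nat) (c : {mpoly k[p.+1]}).

Lemma pscale_is_linear : linear (@pscale k p n c).
Proof.
by move=> a x y; apply/ffunP=> w; rewrite !ffunE mulrDr scalerAr.
Qed.

HB.instance Definition _ := GRing.isLinear.Build k (tforms k p n) (tforms k p n)
  _ (@pscale k p n c) pscale_is_linear.

Definition forms_mul : {linear forms k p n -> forms k p n} :=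
  mquot_map (I := form_ideal k p n) (J := form_ideal k p n)
    (u := @pscale k p n c) (@form_idealM k p n c).

End Multiplication.

Lemma forms_mul_pull p q (a : delta p q) c x :
  forms_pull k a n (forms_mul c x) =
  forms_mul (subst_t a c) (forms_pull k a n x).
Proof.
rewrite -(mquot_reprK x) /forms_pull /forms_mul /= !mquot_mapE /=.
by rewrite tforms_pull_pscale.
Qed.

(** The barycentric coordinates are a partition of unity, as [sum_i t_i - 1] lies in the ideal. *)
Lemma sum_forms_mulX p x : \sum_(i < p.+1) forms_mul 'X_i x = x.
Proof.
rewrite -[RHS](mquot_reprK x) /forms_mul /=.
under eq_bigr do rewrite -{1}(mquot_reprK x) mquot_mapE /=.
rewrite -raddf_sum; apply/mquot_piP.
suff -> : \sum_(i < p.+1) pscale 'X_i (mquot_repr x) - mquot_repr x =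
  pscale (\sum_(i < p.+1) 'X_i - 1) (mquot_repr x) by exact: form_ideal_sumt.
by apply/ffunP=> w; rewrite !ffunE sum_ffunE mulrBl mul1r mulr_suml;
  under eq_bigr do rewrite ffunE.
Qed.

Lemma forms_mul0 p x : forms_mul (0 : {mpoly k[p.+1]}) x = 0.
Proof.
rewrite -(mquot_reprK x) /forms_mul /= mquot_mapE -[RHS](raddf0 (mquot_pi _)).
by congr mquot_pi; apply/ffunP=> w; rewrite !ffunE mul0r.
Qed.

End FormsFunctor.

(** * Functoriality and differences for tensor products *)

Section TensorRight.
Variables (R S : comPzRingType) (f : {rmorphism R -> S}) (M : lmodType R).

Lemma tens_mapr_comp (N1 N2 N3 : lmodType S)
    (u : {linear N1 -> N2}) (v : {linear N2 -> N3}) (w : {linear N1 -> N3}) :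
  (forall x, w x = v (u x)) ->
  forall x, tens_mapr f M w x = tens_mapr f M v (tens_mapr f M u x).
Proof.
move=> wE; apply: (@tens_additive_ext _ _ _ _ _ _ _ (_ \o _)) => m n /=.
by rewrite !tens_mapr_tmul wE.
Qed.

Lemma tens_mapr_id (N : lmodType S) (u : {linear N -> N}) :
  u =1 id -> tens_mapr f M u =1 id.
Proof.
move=> uE; apply: (@tens_additive_ext _ _ _ _ _ _ _ idfun) => m n /=.
by rewrite tens_mapr_tmul uE.
Qed.

Lemma tmul0 (N : lmodType S) (m : M) : tmul f m (0 : N) = 0.
Proof. by rewrite -[0 in LHS](scale0r 0) tmulZ scale0r. Qed.

Lemma tmul0l (N : lmodType S) (x : N) : tmul f (0 : M) x = 0.
Proof. by rewrite -[0 in LHS](scale0r 0) tmul_bal rmorph0 scale0r tmul0. Qed.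

Lemma tens_mapr0 (N1 N2 : lmodType S) (u : {linear N1 -> N2}) :
  (forall x, u x = 0) -> forall x, tens_mapr f M u x = 0.
Proof.
move=> uE; apply: (@tens_additive_ext _ _ _ _ _ _ _ \0) => m n /=.
by rewrite tens_mapr_tmul uE tmul0.
Qed.

End TensorRight.

Section TensorSub.
Variables (R S : comPzRingType) (f : {rmorphism R -> S}).

Lemma tens_mapl_sub (M M' : lmodType R) (N : lmodType S)
    (u v w : {linear M -> M'}) :
  (forall x, w x = u x - v x) ->
  forall x, tens_mapl f N w x = tens_mapl f N u x - tens_mapl f N v x.
Proof.
move=> wE; elim/tens_ind => [|x y IHx IHy|x a].
- by rewrite !raddf0 addr0.
- by rewrite !raddfD /= IHx IHy addrACA.
- rewrite !tens_mapl_tmul wE tmulDl -[- v x]scaleN1r tmul_bal rmorphN1 tmulZ.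
  by rewrite scaleN1r.
Qed.

Lemma tens_mapr_sub (M : lmodType R) (N N' : lmodType S)
    (u v w : {linear N -> N'}) :
  (forall x, w x = u x - v x) ->
  forall x, tens_mapr f M w x = tens_mapr f M u x - tens_mapr f M v x.
Proof.
move=> wE; elim/tens_ind => [|x y IHx IHy|m x].
- by rewrite !raddf0 addr0.
- by rewrite !raddfD /= IHx IHy addrACA.
- by rewrite !tens_mapr_tmul wE tmulDr -[- v x]scaleN1r tmulZ scaleN1r.
Qed.

End TensorSub.

(** * Projection onto the normalization *)

Section NormalProjection.
Variables (A : comPzRingType) (X : cosimplicial A) (q : nat).

Fixpoint normal_proj (r : nat) : {linear X q -> X q} :=
  if r is r'.+1 then (idfun \- cmap X (collapse q r')) \o normal_proj r'
  else idfun.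

(** Let [e_i] be the action of [collapse q i]. Then [e_r (1 - e_r) = 0], and for [i < r] the
    identity [e_i e_r = e_i e_r e_i] shows that [1 - e_r] preserves the kernel of [e_i]. *)
Lemma normal_projP r i x : (i < r)%N ->
  cmap X (collapse q i) (normal_proj r x) = 0.
Proof.
elim: r i => [//|r IH] i; rewrite ltnS leq_eqVlt /= raddfB /=.
have absorb j : (j <= r)%N -> delta_comp (collapse q j) (collapse q r) =
    delta_comp (delta_comp (collapse q j) (collapse q r)) (collapse q j).
  move=> jr; rewrite [RHS]collapse_absorb // => y z yj zj; apply: val_inj.
  by rewrite /= !collapse_funE yj zj; do 4?case: eqP; lia.
case/predU1P => [->|ir].
  rewrite -cmap_comp (_ : delta_comp _ _ = collapse q r) ?subrr //.
  apply: collapse_absorb => y z yr zr; apply: val_inj.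
  by rewrite /= !collapse_funE yr zr; do 2?case: eqP; lia.
rewrite -cmap_comp absorb; last exact: ltnW.
by rewrite cmap_comp IH // raddf0 subrr.
Qed.

End NormalProjection.

Lemma normal_proj_normalization (A : comPzRingType) (X : cosimplicial A) q x :
  @normalization A X q (normal_proj X q q x).
Proof.
case: q x => [//|m] x j.
by rewrite -(codegen_collapse j) cmap_comp (normal_projP _ (ltn_ord j)) raddf0.
Qed.

(** * Compatible families built from one component *)

Section Spread.
Variables (k : fieldType) (A : comPzRingType) (f : {rmorphism k -> A}).
Variables (X : cosimplicial A) (n : nat).

Local Notation W p q := (tens f (forms k p n) (X q)).
Local Notation pull a := (tens_mapl f _ (forms_pull k a n)).
Local Notation push a := (tens_mapr f _ (cmap X a)).
Local Notation mul c := (tens_mapl f _ (forms_mul n c)).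

Lemma pull_comp p q r s (b : delta q r) (a : delta p q) (y : W r s) :
  pull (delta_comp b a) y = pull a (pull b y).
Proof. by apply: tens_mapl_comp => x; apply: forms_pull_comp. Qed.

Lemma push_comp p q r s (b : delta q r) (a : delta p q) (y : W s p) :
  push (delta_comp b a) y = push b (push a y).
Proof. by apply: tens_mapr_comp => x; apply: cmap_comp. Qed.

Lemma pull_id p q (y : W p q) : pull (delta_id p) y = y.
Proof. by apply: tens_mapl_id => x; apply: forms_pull_id. Qed.

Lemma push_id p q (y : W p q) : push (delta_id q) y = y.
Proof. by apply: tens_mapr_id => x; apply: cmap_id. Qed.

Lemma pull_mul p p' q (a : delta p p') c (y : W p' q) :
  pull a (mul c y) = mul (subst_t a c) (pull a y).
Proof.
rewrite -(tens_mapl_comp (w := forms_pull k a n \o forms_mul n c)) //.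
by apply: tens_mapl_comp => x /=; apply: forms_mul_pull.
Qed.

Lemma tens_mul0 p q (y : W p q) : mul (0 : {mpoly k[p.+1]}) y = 0.
Proof. by apply: tens_mapl0 => x; apply: forms_mul0. Qed.

Lemma sum_tens_mulX p q (y : W p q) : \sum_(i < p.+1) mul 'X_i y = y.
Proof.
elim/tens_ind: y => [|x y IHx IHy|m x].
- by rewrite big1 // => i _; rewrite raddf0.
- rewrite -[in RHS]IHx -[in RHS]IHy -big_split; apply: eq_bigr => i _.
  by rewrite raddfD.
under eq_bigr do rewrite tens_mapl_tmul.
have tmul_sum (J : Type) (r : seq J) (F : J -> forms k p n) :
    \sum_(j <- r) tmul f (F j) x = tmul f (\sum_(j <- r) F j) x.
  elim: r => [|j r IH]; last by rewrite !big_cons tmulDl IH.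
  by rewrite !big_nil tmul0l.
by rewrite tmul_sum sum_forms_mulX.
Qed.

(** Membership in [Ω_p ⊗ N^q(X)]. *)
Definition normalized p q (y : W p q) : Prop :=
  forall i, (i < q)%N -> push (collapse q i) y = 0.

Lemma push_nonincreasing p q r (a : delta q r) (y : W p q) :
  normalized y -> ~~ increasing a -> push a y = 0.
Proof.
move=> ny /nonincreasing_absorb[i iq <-].
by rewrite push_comp ny // raddf0.
Qed.

Definition proj p q : {linear W p q -> W p q} :=
  tens_mapr f (forms k p n) (normal_proj X q q).

Lemma proj_normalized p q (y : W p q) : normalized (proj p q y).
Proof.
move=> i iq; rewrite /proj /=.
rewrite -(tens_mapr_comp (w := cmap X (collapse q i) \o normal_proj X q q)) //.
by apply: tens_mapr0 => x /=; apply: normal_projP.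
Qed.

Lemma proj_id p q (y : W p q) : normalized y -> proj p q y = y.
Proof.
move=> ny; rewrite /proj /=; suff: forall r, (r <= q)%N ->
    tens_mapr f (forms k p n) (normal_proj X q r) y = y by apply.
elim=> [_|r IH rq] /=; first exact: tens_mapr_id.
rewrite (tens_mapr_comp (u := normal_proj X q r)
  (v := idfun \- cmap X (collapse q r))) // IH; last exact: ltnW.
rewrite (tens_mapr_sub (u := idfun) (v := cmap X (collapse q r))) //.
by rewrite ny // subr0 tens_mapr_id.
Qed.

Section CutSum.
Variables (m r : nat).

(** This is [u_i]. The cosimplicial degree [r] is kept independent of [m] because [push] changes
    it. *)
Definition cut_sum q (i : {ffun 'I_m.+1 -> 'I_q.+1}) (y : W m.+1 r) : W q r :=
  \sum_(j : {ffun 'I_m.+1 -> 'I_q.+2})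
     f (cuts_weight k i j) *: pull (cut_map j) y.

Lemma cut_sum_is_linear q i : linear (@cut_sum q i).
Proof.
move=> c y z; rewrite /cut_sum scaler_sumr -big_split; apply: eq_bigr => j _.
by rewrite linearP scalerDr !scalerA mulrC.
Qed.

HB.instance Definition _ q i :=
  GRing.isLinear.Build A (W m.+1 r) (W q r) _ (@cut_sum q i) (cut_sum_is_linear i).

(** Pulling back along [b] replaces cuts by their pullbacks; once equal pullbacks are grouped,
    [sum_cuts_weight] matches the coefficients. *)
Lemma pull_cut_sum p q (b : delta p q) i (y : W m.+1 r) :
  pull b (cut_sum i y) =
  \sum_(i' : {ffun 'I_m.+1 -> 'I_p.+1} | [ffun l => b (i' l)] == i) cut_sum i' y.
Proof.
rewrite /cut_sum exchange_big raddf_sum /=.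
under [RHS]eq_bigr do rewrite -scaler_suml -rmorph_sum sum_cuts_weight.
rewrite (partition_big (fun j : {ffun 'I_m.+1 -> 'I_q.+2} =>
  [ffun l => pull_cut b (j l)]) predT) //=; apply: eq_bigr => j' _.
rewrite rmorph_sum scaler_suml; apply: eq_bigr => j /eqP jj'.
rewrite linearZ /= -pull_comp cut_map_comp; congr (_ *: pull _ _).
apply: delta_ext => x; apply: val_inj => /=.
by apply: eq_bigr => l _; rewrite -jj' ffunE.
Qed.

End CutSum.

Definition spread m q (y : W m.+1 m) : W q q :=
  \sum_(i : {ffun 'I_m.+1 -> 'I_q.+1} | increasing i)
     push (delta_of i) (cut_sum i y).

Lemma spread_is_linear m q : linear (@spread m q).
Proof.
move=> c y z; rewrite /spread scaler_sumr -big_split; apply: eq_bigr => j _.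
by rewrite !linearP.
Qed.

HB.instance Definition _ m q :=
  GRing.isLinear.Build A (W m.+1 m) (W q q) _ (@spread m q) (@spread_is_linear m q).

Lemma push_cut_sum m p q (a : delta m q) i (y : W m.+1 m) :
  push a (@cut_sum m m p i y) = cut_sum i (push a y).
Proof.
rewrite /cut_sum raddf_sum; apply: eq_bigr => j _ /=.
by rewrite linearZ /= tens_maplr.
Qed.

(** On the right, only the [i] with [b i] increasing survive; grouping them by [b i] gives the sum
    of [pull_cut_sum]. *)
Lemma spread_compat m p q (b : delta p q) (y : W m.+1 m) : normalized y ->
  pull b (spread q y) = push b (spread p y).
Proof.
move=> ny; rewrite /spread !raddf_sum /=.
pose im (i : {ffun 'I_m.+1 -> 'I_p.+1}) : {ffun 'I_m.+1 -> 'I_q.+1} :=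
  [ffun l => b (i l)].
(* If [b i] is not increasing, it factors through some [collapse], which kills normalized
   elements. *)
rewrite [RHS](bigID (fun i => increasing (im i))) /= [X in _ + X]big1 ?addr0; last first.
  move=> i /andP[ii bi]; rewrite -push_comp push_cut_sum push_nonincreasing ?raddf0 //.
  apply: contra bi => /increasingP h; apply/increasingP => x z /h.
  by rewrite /im !ffunE /= !delta_ofE.
rewrite [RHS](partition_big im (fun i' => increasing i')) /=; last first.
  by move=> i /andP[].
apply: eq_bigr => i' ii'; rewrite tens_maplr pull_cut_sum raddf_sum /=.
(* Lifts of increasing maps along the monotone [b] are increasing, so both index sets agree. *)
have lift_inc i : im i = i' -> increasing i.
  move=> ii; apply/increasingP => x z xz.
  move/increasingP: ii' => /(_ x z xz); rewrite -ii /im !ffunE.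
  by apply: contraLR; rewrite -!leqNgt; apply: delta_homo.
apply: eq_big => [i|i /eqP ii].
  rewrite -/(im i); case: eqP => [ii|]; rewrite ?andbF // ii lift_inc //.
  by rewrite ii'.
rewrite -push_comp; congr (tens_mapr _ _ (cmap X _) _).
apply: delta_ext => x /=; rewrite !delta_ofE ?lift_inc //.
by rewrite -ii /im ffunE.
Qed.

(** A right inverse of the boundary [sum_r (-1)^r d_r] on those elements of
    [Ω_m ⊗ X^q] all of whose faces vanish, up to a global sign. *)
Definition cone m q (y : W m q) : W m.+1 q :=
  \sum_(r < m.+1)
    f ((-1) ^+ (m.+1 - r)) *: mul 'X_(lift ord0 r) (pull (codegen r) y).

Lemma cone_is_linear m q : linear (@cone m q).
Proof.
move=> c y z; rewrite /cone scaler_sumr -big_split; apply: eq_bigr => j _.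
by rewrite !linearP.
Qed.

HB.instance Definition _ m q :=
  GRing.isLinear.Build A (W m q) (W m.+1 q) _ (@cone m q) (@cone_is_linear m q).

Lemma push_cone m q q' (a : delta q q') (y : W m q) :
  push a (cone y) = cone (push a y).
Proof.
rewrite /cone raddf_sum; apply: eq_bigr => j _ /=.
by rewrite linearZ /= -!tens_maplr.
Qed.

Lemma cone_normalized m q (y : W m q) : normalized y -> normalized (cone y).
Proof. by move=> ny i iq; rewrite push_cone ny // raddf0. Qed.

Lemma extension_compat m (w : W m m) :
  ts_compat (fun q => spread q (cone (proj m m w))).
Proof.
by move=> p q a; apply/spread_compat/cone_normalized/proj_normalized.
Qed.

(** This is [e_m]; projecting first makes it defined on all of [Ω_m ⊗ X^m]. *)
Definition extension m (w : W m m) : ts_term f X n := TSTerm (extension_compat w).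

Lemma extension_is_linear m : linear (@extension m).
Proof. by move=> c y z; apply: ts_ext => p /=; rewrite !linearP. Qed.

HB.instance Definition _ m :=
  GRing.isLinear.Build A (W m m) (ts_term f X n) _ (@extension m)
    (@extension_is_linear m).

Definition ts_component m (x : ts_term f X n) : W m m := x m.

Lemma ts_component_is_linear m : linear (ts_component m).
Proof. by []. Qed.

HB.instance Definition _ m :=
  GRing.isLinear.Build A (ts_term f X n) (W m m) _ (ts_component m)
    (@ts_component_is_linear m).

(** By compatibility a codegeneracy sends [x m] to a pullback of the previous component, which
    vanishes. *)
Lemma component_normalized m (x : ts_term f X n) :
  (forall i, (i < m)%N -> x i = 0) -> normalized (x m).
Proof.
move=> x0 i im; case: m i im x0 => [//|m] i im x0.
rewrite (_ : collapse _ _ =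
  delta_comp (coface (lift ord0 (Ordinal im))) (codegen (Ordinal im))).
  by rewrite push_comp -ts_valP (x0 m) // !raddf0.
exact: collapse_factor (Ordinal im).
Qed.

Lemma extension_lt m i (w : W m m) : (i < m)%N -> extension w i = 0.
Proof.
move=> im; apply: big_pred0 => j; apply/negP => /increasing_dim.
by rewrite leqNgt im.
Qed.

(** Expanding [cut_sum] and [cone] gives a double sum over cuts [j] and vertices [r]. For each [r] a
    single [j] survives and contributes [t_r] times [x m]; the partition of unity concludes. *)
Lemma extension_component m (x : ts_term f X n) :
  (forall i, (i < m)%N -> x i = 0) -> extension (x m) m = x m.
Proof.
move=> x0; have nx := component_normalized x0.
rewrite /= proj_id // /spread.
pose i0 : {ffun 'I_m.+1 -> 'I_m.+1} := [ffun l => l].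
rewrite (big_pred1 i0) => [|i]; last first.
  apply/idP/eqP => [/increasing_id ii|->].
    by apply/ffunP => l; rewrite ffunE ii.
  by apply/increasingP => y z; rewrite !ffunE.
have -> : delta_of i0 = delta_id m.
  apply: delta_ext => l; rewrite delta_ofE ?ffunE //.
  by apply/increasingP => y z; rewrite !ffunE.
rewrite push_id.
(* Compatibility turns this pullback into a [push], which vanishes on normalized elements. *)
have pullx (a : delta m m) : ~~ increasing a -> pull a (x m) = 0.
  by move=> ai; rewrite ts_valP push_nonincreasing.
pose G (j : {ffun 'I_m.+1 -> 'I_m.+2}) (r : 'I_m.+1) : W m m :=
  f (cuts_weight k i0 j) *: pull (cut_map j)
    (f ((-1) ^+ (m.+1 - r)) *: mul 'X_(lift ord0 r) (pull (codegen r) (x m))).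
transitivity (\sum_r \sum_j G j r).
  by rewrite exchange_big; apply: eq_bigr => j _; rewrite -scaler_sumr -raddf_sum.
rewrite -[RHS]sum_tens_mulX; apply: eq_bigr => r _.
have GE j : G j r = f (cuts_weight k i0 j * (-1) ^+ (m.+1 - r)) *:
    mul (subst_t (cut_map j) 'X_(lift ord0 r))
      (pull (delta_comp (codegen r) (cut_map j)) (x m)).
  by rewrite /G linearZ /= scalerA -rmorphM pull_mul -pull_comp.
(* For [face_cuts r] the signs of [cut_sum] and [cone] cancel, and [t_{r+1}] pulls back to [t_r]. *)
rewrite (bigD1 (face_cuts r)) //= big1 ?addr0 => [|j jr]; rewrite GE.
  rewrite cuts_weight_face -expr2 sqrr_sign rmorph1 scale1r.
  rewrite codegen_cut_map_face pull_id subst_tX (big_pred1 r) // => y.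
  rewrite /= -val_eqE [val _]cut_map_face -val_eqE /= /bump /=.
  by case: (ltngtP r y) => //; lia.
have [->|wj] := eqVneq (cuts_weight k i0 j) 0.
  by rewrite mul0r rmorph0 scale0r.
have [inc|/pullx ->] := boolP (increasing (delta_comp (codegen r) (cut_map j))); last first.
  by rewrite !raddf0.
(* Now [codegen r] after [cut_map j] is the identity, so a vertex sent to [r+1] would force [j] to
   be [face_cuts r]. *)
rewrite subst_tX big1 ?tens_mul0 ?scaler0 // => y /eqP yr.
by case/eqP: jr; apply: face_cuts_unique wj (increasing_id inc) yr.
Qed.

End Spread.

(** * Successive elimination of components *)

Section Elimination.
Variables (k : fieldType) (A : comPzRingType) (f : {rmorphism k -> A}).
Variables (X : cosimplicial A) (n : nat).

Fixpoint eliminate (r : nat) : {linear ts_term f X n -> ts_term f X n} :=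
  if r is r'.+1 then
    (idfun \- (@extension k A f X n r' \o ts_component r')) \o eliminate r'
  else idfun.

(** The operator [1 - T_r] kills the component in degree [r], and [T_r] adds nothing in lower
    degrees. *)
Lemma eliminate_lt r i (x : ts_term f X n) : (i < r)%N -> eliminate r x i = 0.
Proof.
elim: r i => [//|r IH] i; rewrite ltnS leq_eqVlt => /predU1P[->|ir];
  rewrite -[LHS]/(eliminate r x _ - extension (eliminate r x r) _).
  by rewrite extension_component ?subrr.
by rewrite extension_lt // IH // subr0.
Qed.

Variable d : nat.
Hypothesis X0 : forall q (x : X q), (d <= q)%N -> normal_proj X q q x = 0.

(** By strong induction: once the lower components vanish, [x q] is normalized, hence equal to its
    own projection, which is zero for [q >= d]. *)
Lemma ts_term_eq0 (x : ts_term f X n) : (forall i, (i < d)%N -> x i = 0) -> x = 0.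
Proof.
move=> xd; apply: ts_ext => q; elim/ltn_ind: q => q IH.
have [qd|dq] := ltnP q d; first exact: xd.
rewrite -(@proj_id _ _ _ _ _ _ _ (x q)); last exact: component_normalized.
by apply: tens_mapr0 => y; apply: X0.
Qed.

Lemma eliminate_eq0 (x : ts_term f X n) : eliminate d x = 0.
Proof. by apply: ts_term_eq0 => i; apply: eliminate_lt. Qed.

End Elimination.

(** * Associativity of the tensor product under base change *)

Section ExtAssoc.
Variables (k : fieldType) (A A' : comPzRingType).
Variables (f : {rmorphism k -> A}) (g : {rmorphism A -> A'}).
Variables (M : lmodType k) (N : lmodType A).
Let f' : {rmorphism k -> A'} := g \o f.

Lemma tens_unassoc_balanced1 (m : M) :
  balanced g (fun (x : N) (a : A'^o) => tmul g (tmul f m x) a).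
Proof.
split=> [x y a|x a b|r x a]; first by rewrite tmulDr tmulDl.
  exact: tmulDr.
by rewrite tmulZ tmul_bal.
Qed.

Definition tens_unassoc1 (m : M) : ext_scalars g N -> ext_scalars g (tens f M N) :=
  tens_lift (fun (x : N) (a : A'^o) => tmul g (tmul f m x) a).

Definition tens_unassoc : tens f' M (ext_scalars g N) -> ext_scalars g (tens f M N) :=
  tens_lift tens_unassoc1.

Lemma tens_unassoc_balanced : balanced f' tens_unassoc1.
Proof.
rewrite /tens_unassoc1; split=> [m m' y|m y z|r m y]; last 1 first.
- elim/tens_ind: y => [|y z IHy IHz|x a].
  + by rewrite scaler0 !(tens_lift0 (tens_unassoc_balanced1 _)).
  + by rewrite scalerDr !(tens_liftD (tens_unassoc_balanced1 _)) IHy IHz.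
  + rewrite -tmulZ !(tens_lift_tmul (tens_unassoc_balanced1 _)).
    by rewrite tmul_bal tmulZ tmul_bal.
- elim/tens_ind: y => [|y z IHy IHz|x a].
  + by rewrite !(tens_lift0 (tens_unassoc_balanced1 _)) addr0.
  + by rewrite !(tens_liftD (tens_unassoc_balanced1 _)) IHy IHz addrACA.
  + by rewrite !(tens_lift_tmul (tens_unassoc_balanced1 _)) !tmulDl.
- exact: (tens_liftD (tens_unassoc_balanced1 _)).
Qed.


(** Written through [tens_ext], which is how [base_change_fun] acts on each component. *)
Definition tens_assoc : ext_scalars g (tens f M N) -> tens f' M (ext_scalars g N) :=
  tens_lift (fun y (a : A'^o) => (a : A') *: tens_ext g y).

Lemma tens_assoc_balanced :
  balanced g (fun (y : tens f M N) (a : A'^o) => (a : A') *: tens_ext g y).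
Proof.
split=> [x y a|x a b|r x a].
- by rewrite tens_ext_is_additive scalerDr.
- by rewrite scalerDl.
- by rewrite tens_extZ scalerA mulrC.
Qed.

Lemma tens_assoc_tmul y a : tens_assoc (tmul g y a) = (a : A') *: tens_ext g y.
Proof. exact/tens_lift_tmul/tens_assoc_balanced. Qed.

Lemma tens_assocD : {morph tens_assoc : x y / x + y}.
Proof. exact/tens_liftD/tens_assoc_balanced. Qed.

Lemma tens_assoc0 : tens_assoc 0 = 0.
Proof. exact/tens_lift0/tens_assoc_balanced. Qed.

Lemma tens_unassoc_tmul m x a :
  tens_unassoc (tmul f' m (tmul g x a : ext_scalars g N)) = tmul g (tmul f m x) a.
Proof.
rewrite [LHS](tens_lift_tmul tens_unassoc_balanced).
exact: (tens_lift_tmul (tens_unassoc_balanced1 _)).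
Qed.

Lemma tens_unassocD : {morph tens_unassoc : x y / x + y}.
Proof. exact/tens_liftD/tens_unassoc_balanced. Qed.

Lemma tens_unassoc0 : tens_unassoc 0 = 0.
Proof. exact/tens_lift0/tens_unassoc_balanced. Qed.

Lemma tens_assoc_tmul2 m x (a : A'^o) :
  tens_assoc (tmul g (tmul f m x) a) = tmul f' m (tmul g x a : ext_scalars g N).
Proof.
rewrite tens_assoc_tmul tens_ext_tmul /ext_unit -!tmulZ.
by congr (tmul _ _ (tmul _ _ _)); apply: mulr1.
Qed.

Lemma tens_assocK : cancel tens_assoc (tens_unassoc).
Proof.
elim/tens_ind => [|x y IHx IHy|y a].
- by rewrite tens_assoc0 tens_unassoc0.
- by rewrite tens_assocD tens_unassocD IHx IHy.
elim/tens_ind: y => [|x y IHx IHy|m x].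
- by rewrite tmul0l tens_assoc0 tens_unassoc0.
- by rewrite tmulDl tens_assocD tens_unassocD IHx IHy.
by rewrite tens_assoc_tmul2 tens_unassoc_tmul.
Qed.

Lemma tens_unassocK : cancel (tens_unassoc) tens_assoc.
Proof.
elim/tens_ind => [|x y IHx IHy|m y].
- by rewrite tens_unassoc0 tens_assoc0.
- by rewrite tens_unassocD tens_assocD IHx IHy.
elim/tens_ind: y => [|x y IHx IHy|x a].
- by rewrite tmul0 tens_unassoc0 tens_assoc0.
- by rewrite tmulDr tens_unassocD tens_assocD IHx IHy.
by rewrite tens_unassoc_tmul tens_assoc_tmul2.
Qed.

End ExtAssoc.

(** * Naturality and bijectivity of base change *)

Section BaseChangeBijective.
Variables (k : fieldType) (A A' : comPzRingType).
Variables (f : {rmorphism k -> A}) (g : {rmorphism A -> A'}).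
Variables (X : cosimplicial A) (n : nat).
Let f' : {rmorphism k -> A'} := g \o f.
Let X' := cosimplicial_ext g X.

Lemma normal_proj_ext_tmul q r (x : X q) (a : A'^o) :
  normal_proj X' q r (tmul g x a) = tmul g (normal_proj X q r x) a.
Proof.
elim: r => [//|r IH] /=; rewrite IH tens_mapl_tmul.
by rewrite tmulDl -scaleN1r -[- cmap _ _ _]scaleN1r tmul_bal rmorphN1 tmulZ.
Qed.

(** Vanishing of an operator can be tested on pure tensors, whereas kernels need not commute with
    base change; hence the use of the projector. *)
Lemma normal_proj_ext_eq0 q :
  (forall x : X q, normal_proj X q q x = 0) ->
  forall x : X' q, normal_proj X' q q x = 0.
Proof.
move=> X0; elim/tens_ind => [|x y IHx IHy|x a]; first exact: raddf0.
  by rewrite raddfD /= IHx IHy addr0.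
by rewrite normal_proj_ext_tmul X0 tmul0l.
Qed.

Local Notation W p q := (tens f (forms k p n) (X q)).

Lemma tens_ext_pull p p' q (a : delta p p') (y : W p' q) :
  tens_ext g (tens_mapl f (X q) (forms_pull k a n) y) =
  tens_mapl f' (X' q) (forms_pull k a n) (tens_ext g y).
Proof. exact: tens_ext_mapl. Qed.

Lemma tens_ext_push p q q' (a : delta q q') (y : W p q) :
  tens_ext g (tens_mapr f (forms k p n) (cmap X a) y) =
  tens_mapr f' (forms k p n) (cmap X' a) (tens_ext g y).
Proof. by apply: tens_ext_mapr => x; apply: tens_mapl_tmul. Qed.

Lemma tens_ext_proj p q (y : W p q) :
  tens_ext g (proj f X n p q y) = proj f' X' n p q (tens_ext g y).
Proof. by apply: tens_ext_mapr => x; apply: normal_proj_ext_tmul. Qed.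

Lemma tens_ext_sum (M : lmodType k) (N : lmodType A) (J : Type) (r : seq J)
    (P : pred J) (F : J -> tens f M N) :
  tens_ext g (\sum_(j <- r | P j) F j) = \sum_(j <- r | P j) tens_ext g (F j).
Proof.
exact: (big_morph _ (@tens_ext_is_additive _ _ _ f g M N) (tens_ext0 _ _ _ _)).
Qed.

(** Naturality of [e_m]: each operation in its construction commutes with [tens_ext]. *)
Lemma ts_extend_extension m (y : W m m) :
  ts_extend g (extension y) = @extension _ _ f' X' n m (tens_ext g y).
Proof.
apply: ts_ext => q /=; rewrite -tens_ext_proj /spread tens_ext_sum.
apply: eq_bigr => i _; rewrite tens_ext_push; congr (tens_mapr _ _ _ _).
rewrite /cut_sum tens_ext_sum; apply: eq_bigr => j _.
rewrite tens_extZ tens_ext_pull; congr (_ *: tens_mapl _ _ _ _).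
rewrite /cone tens_ext_sum; apply: eq_bigr => r _.
by rewrite tens_extZ tens_ext_mapl tens_ext_pull.
Qed.

Local Notation E := (ts_term f X n).
Local Notation bc := (@base_change_fun _ _ _ f g X n).

Lemma base_change_component m (y : ext_scalars g E) :
  bc y m = tens_assoc (tens_mapl g A'^o (@ts_component _ _ f X n m) y).
Proof.
elim/tens_ind: y => [|y z IHy IHz|x a].
- by rewrite !raddf0 tens_assoc0.
- by rewrite !raddfD /= tens_assocD IHy IHz.
- by rewrite base_change_tmul tens_mapl_tmul tens_assoc_tmul.
Qed.

Lemma base_change_extension m (w : ext_scalars g (W m m)) :
  bc (tens_mapl g A'^o (@extension _ _ f X n m) w) =
  @extension _ _ f' X' n m (tens_assoc w).
Proof.
elim/tens_ind: w => [|y z IHy IHz|x a].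
- by rewrite tens_assoc0 !raddf0.
- by rewrite tens_assocD !raddfD /= IHy IHz.
- rewrite tens_mapl_tmul base_change_tmul tens_assoc_tmul linearZ.
  by rewrite ts_extend_extension.
Qed.

Variable d : nat.
Hypothesis X0 : forall q (x : X q), (d <= q)%N -> normal_proj X q q x = 0.

(** Since [tens_assoc] is injective, a kernel element has zero components, so every [1 - T_r] fixes
    it; but their product up to [d] is zero. *)
Lemma base_change_inj : injective bc.
Proof.
move=> y y' yy'; apply/eqP; rewrite -subr_eq0; apply/eqP.
have {yy'} : bc (y - y') = 0 by rewrite raddfB /= yy' subrr.
move: {y y'}(y - y') => y y0.
have {y0} yE m : tens_mapl g A'^o (@ts_component _ _ f X n m) y = 0.
  by rewrite -[LHS]tens_assocK -base_change_component y0 [_ m]/= tens_unassoc0.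
have yr r : tens_mapl g A'^o (@eliminate _ _ f X n r) y = y.
  elim: r => [|r IH]; first exact: tens_mapl_id.
  rewrite (tens_mapl_comp (u := @eliminate _ _ f X n r)
    (v := idfun \- (@extension _ _ f X n r \o ts_component r))) // IH.
  rewrite (tens_mapl_sub (u := idfun) (v := @extension _ _ f X n r \o ts_component r)) //.
  rewrite [X in X - _]tens_mapl_id // (tens_mapl_comp (u := @ts_component _ _ f X n r)
    (v := @extension _ _ f X n r)) //.
  by rewrite yE raddf0 subr0.
rewrite -(yr d); apply: tens_mapl0 => x; exact: eliminate_eq0.
Qed.

(** Each [T_r] of the remainder lies in the image, since its component lifts through [tens_assoc];
    after [d] steps the remainder is zero. *)
Lemma base_change_surj (x : ts_term f' X' n) : exists y, bc y = x.
Proof.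
have [y xy] : exists y, x = bc y + @eliminate _ _ f' X' n d x.
  elim: d => [|r [y xy]]; first by exists 0; rewrite raddf0 add0r.
  (* The lift of the component of the remainder that the next elimination step uses. *)
  pose w := tens_unassoc (@eliminate _ _ f' X' n r x r).
  exists (y + tens_mapl g A'^o (@extension _ _ f X n r) w).
  rewrite raddfD /= base_change_extension tens_unassocK.
  by rewrite -addrA [X in _ + X]addrC subrK.
exists y; rewrite [RHS]xy eliminate_eq0 ?addr0 // => q z dq.
by apply: normal_proj_ext_eq0 => t; apply: X0.
Qed.

End BaseChangeBijective.

(** * Assembly into an isomorphism of complexes *)

Theorem corollary6p13 (k : fieldType) (A A' : comPzRingType)
    (f : {rmorphism k -> A}) (g : {rmorphism A -> A'}) (X : cosimplicial A) :
  [pchar k] =i pred0 ->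
  finite_dimensional X ->
  chain_iso (base_change f g X).
Proof.
move=> _ [d Xd].
have X0 q (x : X q) : (d <= q)%N -> normal_proj X q q x = 0.
  by move=> dq; apply: Xd dq _ _; apply: normal_proj_normalization.
pose D := thom_sullivan (g \o f) (cosimplicial_ext g X).
pose C := complex_ext g (thom_sullivan f X).
pose u n : {linear C n -> D n} := base_change f g X n.
have inv n : exists v : {linear D n -> C n},
    cancel (u n) v /\ cancel v (u n).
  have /choice[w uw] : forall y : D n, exists x, u n x = y := base_change_surj X0.
  have wu x : w (u n x) = x by apply: (base_change_inj X0); apply: uw.
  have w_lin : linear w.
    by move=> a y z; rewrite -[y in LHS]uw -[z in LHS]uw -linearP wu.
  pose wL := GRing.isLinear.Build A' (D n) (C n) _ w w_lin.
  pose wl : {linear D n -> C n} := HB.pack w wL.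
  by exists wl.
pose v n := projT1 (cid (inv n)).
have vK n : cancel (u n) (v n) /\ cancel (v n) (u n) := projT2 (cid (inv n)).
(* The inverses commute with the differentials because [base_change] does. *)
have vP n x : v n.+1 (cdiff D n x) = cdiff C n (v n x).
  rewrite -{1}[x](vK n).2 -(cmorP (base_change f g X)).
  exact: (vK n.+1).1.
by exists (ChainMap vP).
Qed.
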